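(* Let $f:\mathbb{R}^n\to\mathbb{R}$ be convex. Suppose that in a run of the B-GS algorithm (described in the context, with tolerance $\epsilon_{tol}=0$) there is $\bar k\in\mathbb{N}_0$ such that the inner loop of outer iteration $\bar k$ does not terminate (that is, it runs through all $i\in\mathbb{N}_0$). Then $\mathbf{0}\in\partial f(\mathbf{x}_{\bar k})$.
   Context: Notation: $\|\cdot\|$ is the Euclidean norm, $B(\mathbf{x},\varepsilon)$ the closed ball, $\partial f$ the convex subdifferential, $D$ the set of points at which $f$ is differentiable, $\mathbb{N}_0=\{0,1,2,\dots\}$. Input parameters (fixed throughout a run): $\mathbf{x}_0\in D$, $\varepsilon_0>0$, $\mu\in(0,1)$, sample size $m\in\mathbb{N}_0$, $\beta\in(0,1)$, maximum allowable perturbation $\sigma>0$, $\alpha>0$, $\gamma>0$, $\theta\in[0,1]$, $\epsilon_{tol}=0$. Perturbation routines. FDP1$(\mathbf{x},\mathbf{d},\beta,z,\sigma)$ is called when $f(\mathbf{x}+\mathbf{d})-f(\mathbf{x})\le\beta z$: start with $\hat{\mathbf{x}}:=\mathbf{x}$, $\hat\sigma:=\sigma$; as long as it is not the case that ($\hat{\mathbf{x}}+\mathbf{d}\in D$ and $f(\hat{\mathbf{x}}+\mathbf{d})-f(\mathbf{x})\le\beta z$), sample $\hat{\mathbf{x}}$ independently and uniformly from $B(\mathbf{x},\hat\sigma)$ and replace $\hat\sigma$ by $\hat\sigma/2$; finally return $\hat{\mathbf{x}}+\mathbf{d}$. FDP2 is the same routine with ''$\le\beta z$'' replaced everywhere by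 ''$>\beta z$''. B-GS algorithm. Set $k:=0$. Outer iteration $k$: (1) Sample $\mathbf{s}_{k,1},\dots,\mathbf{s}_{k,m}$ independently and uniformly from $B(\mathbf{x}_k,\varepsilon_k)$ and set $\mathbf{s}_{k,0}:=\mathbf{x}_k$. If some $\mathbf{s}_{k,j}\notin D$, stop. For every auxiliary point $\mathbf{s}_{k,j}$ (including those with $j>m$ created below) put $e_{k,j}:=f(\mathbf{x}_k)-f(\mathbf{s}_{k,j})-\langle\nabla f(\mathbf{s}_{k,j}),\mathbf{x}_k-\mathbf{s}_{k,j}\rangle$. (2) Let $\lambda^{k,0}$ minimize $\frac12\|\sum_{j=0}^m\lambda_j\nabla f(\mathbf{s}_{k,j})\|^2+\varepsilon_k^{-\alpha}\sum_{j=0}^m\lambda_je_{k,j}$ subject to $\lambda_j\ge0$, $\sum_{j=0}^m\lambda_j=1$. Set $\tilde{\mathbf{g}}_{k,0}:=\sum_j\lambda^{k,0}_j\nabla f(\mathbf{s}_{k,j})$ and $\tilde e_{k,0}:=\sum_j\lambda^{k,0}_je_{k,j}$. (3) For every $i\geq 0$ reached, set $\mathbf{d}_{k,i}:=-\varepsilon_k^\alpha\tilde{\mathbf{g}}_{k,i}$, $z_{k,i}:=-\varepsilon_k^\alpha\|\tilde{\mathbf{g}}_{k,i}\|^2-\tilde e_{k,i}$, $v_{k,i}:=\frac12\|\tilde{\mathbf{g}}_{k,i}\|^2+\tilde e_{k,i}$. Index sets: $J_{k,0}$ consists of $0$, $m+1$ and the indices of the $l_0$ largest components of $\lambda^{k,0}$,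 where $l_0$ is the largest integer such that the sum of these components is $\le\theta$; for $i\ge1$, $J_{k,i}$ consists of $0$, $m+i+1$ and the indices of the $l_i$ largest components among $(\lambda^{k,i}_j)_{j\in J_{k,i-1}}$, where $l_i$ is the largest integer such that the sum of these components is $\le\theta\sum_{j\in J_{k,i-1}}\lambda^{k,i}_j$. (4) Inner loop, starting with $i:=0$: (a) if $v_{k,i}\le\epsilon_{tol}$, return $\mathbf{x}_k$ and stop; (b) if $f(\mathbf{x}_k+\mathbf{d}_{k,i})-f(\mathbf{x}_k)\le\beta z_{k,i}$, set $\mathbf{x}_{k+1}:=$ FDP1$(\mathbf{x}_k,\mathbf{d}_{k,i},\beta,z_{k,i},\sigma)$, $\varepsilon_{k+1}:=\varepsilon_k$, and leave the inner loop; (c) otherwise set $\mathbf{s}_{k,m+i+1}:=$ FDP2$(\mathbf{x}_k,\mathbf{d}_{k,i},\beta,z_{k,i},\sigma)$. If $e_{k,m+i+1}\le\gamma\tilde e_{k,i}$ or $|f(\mathbf{x}_k+\mathbf{d}_{k,i})-f(\mathbf{x}_k)|\le\frac12\|\tilde{\mathbf{g}}_{k,i}\|^2+\tilde e_{k,i}$, let $\lambda^{k,i+1}=(\lambda_j^{k,i+1}, j\in J_{k,i};\ \tilde\lambda^{k,i+1})$ minimize $\frac12\|\sum_{j\in J_{k,i}}\lambda_j\nabla f(\mathbf{s}_{k,j})+\tilde\lambda\tilde{\mathbf{g}}_{k,i}\|^2+\varepsilon_k^{-\alpha}(\sum_{j\in J_{k,i}}\lambda_je_{k,j}+\tilde\lambda\tilde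 e_{k,i})$ subject to $\lambda_j\ge0$, $\tilde\lambda\ge0$, $\sum_{j\in J_{k,i}}\lambda_j+\tilde\lambda=1$; set $\tilde{\mathbf{g}}_{k,i+1}:=\sum_{j\in J_{k,i}}\lambda^{k,i+1}_j\nabla f(\mathbf{s}_{k,j})+\tilde\lambda^{k,i+1}\tilde{\mathbf{g}}_{k,i}$ and $\tilde e_{k,i+1}:=\sum_{j\in J_{k,i}}\lambda^{k,i+1}_je_{k,j}+\tilde\lambda^{k,i+1}\tilde e_{k,i}$, form $J_{k,i+1}$, replace $i$ by $i+1$ and go to (a). Otherwise set $\varepsilon_{k+1}:=\mu\varepsilon_k$, $\mathbf{x}_{k+1}:=\mathbf{x}_k$ and leave the inner loop. (5) Replace $k$ by $k+1$ and start the next outer iteration.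
   Formalization: The conclusion is proved with probability one, for all k̄ at once, over runs with independent uniform samples and non-anticipating measurable choices of minimizers and ties; for every individual run it fails, since an exceptional sample sequence can keep the inner loop running at a non-minimizer. *)

(* Defs.v *)
From HB Require Import structures.
From mathcomp Require Import all_boot all_order all_algebra finmap.
From mathcomp Require Import all_classical all_reals all_analysis.

Set Implicit Arguments.
Unset Strict Implicit.
Unset Printing Implicit Defensive.

Import Order.TTheory GRing.Theory Num.Theory.
Import numFieldNormedType.Exports.

Local Open Scope classical_set_scope.
Local Open Scope ring_scope.

(* The library norm on matrices is the sup norm, so the Euclidean inner product
   and norm are defined here.  The two norms give the same topology and the same
   notion of (Frechet) differentiability, so [differentiable] is the library's. *)
Definition dotv (R : realType) (n : nat) (x y : 'rV[R]_n) : R :=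
  \sum_(i < n) x 0 i * y 0 i.

Definition enorm (R : realType) (n : nat) (x : 'rV[R]_n) : R :=
  Num.sqrt (dotv x x).

Definition subdiff (R : realType) (n : nat) (f : 'rV[R]_n -> R)
    (x : 'rV[R]_n) : set 'rV[R]_n :=
  [set g | forall y, f x + dotv g (y - x) <= f y].

Definition diffset (R : realType) (n : nat) (f : 'rV[R]_n -> R) :
    set 'rV[R]_n :=
  [set x | differentiable (f : 'rV[R]_n -> R^o) x].

(* Vector of partial derivatives; only meaningful on [diffset f]. *)
Definition grad (R : realType) (n : nat) (f : 'rV[R]_n -> R)
    (x : 'rV[R]_n) : 'rV[R]_n :=
  \row_(i < n) 'D_(delta_mx 0 i) (f : 'rV[R]_n -> R^o) x.

Record bgs_params (R : realType) (n : nat) := BGSParams {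
  p_x0 : 'rV[R]_n;
  p_eps0 : R;
  p_mu : R;
  p_m : nat;
  p_beta : R;
  p_sigma : R;
  p_alpha : R;
  p_gamma : R;
  p_theta : R }.

Definition admissible (R : realType) (n : nat) (f : 'rV[R]_n -> R)
    (p : bgs_params R n) : Prop :=
  [/\ diffset f (p_x0 p),
      0 < p_eps0 p,
      0 < p_mu p < 1,
      0 < p_beta p < 1 &
      [/\ 0 < p_sigma p, 0 < p_alpha p, 0 < p_gamma p & 0 <= p_theta p <= 1]].

(* The record of a run.  [tr_lam tr k i j] is lambda^{k,i}_j and [tr_tlam tr k i]
   is the weight lambda~^{k,i} of the aggregate (used for i >= 1 only).  Entries
   belonging to steps that the run never reaches are arbitrary. *)
Record bgs_trace (R : realType) (n : nat) := BGSTrace {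
  tr_x : nat -> 'rV[R]_n;
  tr_eps : nat -> R;
  tr_s : nat -> nat -> 'rV[R]_n;
  tr_lam : nat -> nat -> nat -> R;
  tr_tlam : nat -> nat -> R;
  tr_J : nat -> nat -> {fset nat} }.

Section Algorithm.
Context (R : realType) (n : nat) (f : 'rV[R]_n -> R) (p : bgs_params R n).

(* The draws are points of the closed unit ball: a point sampled from B(x, r) is
   x + r u with u a draw.  [u k 0 j] yields the auxiliary point s_{k,j+1}, and [u k i.+1 t]
   is the (t+1)-st sample of the perturbation routine called in the inner
   iteration i of the outer iteration k. *)
Context (u : nat -> nat -> nat -> 'rV[R]_n) (tr : bgs_trace R n).

Local Notation m := (p_m p).
Local Notation x := (tr_x tr).
Local Notation eps := (tr_eps tr).
Local Notation s := (tr_s tr).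
Local Notation lam := (tr_lam tr).
Local Notation tlam := (tr_tlam tr).
Local Notation J := (tr_J tr).

Definition lin_err (k j : nat) : R :=
  f (x k) - f (s k j) - dotv (grad f (s k j)) (x k - s k j).

Fixpoint aggr_g (k i : nat) : 'rV[R]_n :=
  match i with
  | 0 => \sum_(j < m.+1) lam k 0%N j *: grad f (s k j)
  | i'.+1 => \sum_(j <- J k i') lam k i j *: grad f (s k j)
             + tlam k i *: aggr_g k i'
  end.

Fixpoint aggr_e (k i : nat) : R :=
  match i with
  | 0 => \sum_(j < m.+1) lam k 0%N j * lin_err k j
  | i'.+1 => \sum_(j <- J k i') lam k i j * lin_err k j
             + tlam k i * aggr_e k i'
  end.

Definition dir (k i : nat) : 'rV[R]_n := - (eps k `^ p_alpha p) *: aggr_g k i.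

Definition zval (k i : nat) : R :=
  - (eps k `^ p_alpha p) * enorm (aggr_g k i) ^+ 2 - aggr_e k i.

Definition vval (k i : nat) : R :=
  2^-1 * enorm (aggr_g k i) ^+ 2 + aggr_e k i.

Definition qp0_feasible (l : nat -> R) : Prop :=
  (forall j, (j <= m)%N -> 0 <= l j) /\ \sum_(j < m.+1) l j = 1.

Definition qp0_obj (k : nat) (l : nat -> R) : R :=
  2^-1 * enorm (\sum_(j < m.+1) l j *: grad f (s k j)) ^+ 2
  + eps k `^ (- p_alpha p) * \sum_(j < m.+1) l j * lin_err k j.

Definition qp0_solution (k : nat) (l : nat -> R) : Prop :=
  qp0_feasible l /\
  forall l', qp0_feasible l' -> qp0_obj k l <= qp0_obj k l'.

(* The problem that determines lambda^{k,i+1} from the inner iteration i. *)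
Definition qp_feasible (k i : nat) (l : nat -> R) (t : R) : Prop :=
  [/\ forall j, j \in J k i -> 0 <= l j, 0 <= t &
      \sum_(j <- J k i) l j + t = 1].

Definition qp_obj (k i : nat) (l : nat -> R) (t : R) : R :=
  2^-1 * enorm (\sum_(j <- J k i) l j *: grad f (s k j)
                + t *: aggr_g k i) ^+ 2
  + eps k `^ (- p_alpha p) * (\sum_(j <- J k i) l j * lin_err k j
                              + t * aggr_e k i).

Definition qp_solution (k i : nat) (l : nat -> R) (t : R) : Prop :=
  qp_feasible k i l t /\
  forall l' t', qp_feasible k i l' t' -> qp_obj k i l t <= qp_obj k i l' t'.

(* [K] consists of the #|K| largest components of [l] on [I]; ties may be broken
   in any way. *)
Definition largest (I : {fset nat}) (l : nat -> R) (K : {fset nat}) : Prop :=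
  (forall a, a \in K -> a \in I) /\
  (forall a b, a \in K -> b \in I -> b \notin K -> l b <= l a).

Definition max_largest (I : {fset nat}) (l : nat -> R) (c : R)
    (K : {fset nat}) : Prop :=
  [/\ largest I l K, \sum_(j <- K) l j <= c &
      forall K' : {fset nat}, largest I l K' -> \sum_(j <- K') l j <= c ->
        (#|` K'| <= #|` K|)%N].

Definition index_set_ok (k i : nat) : Prop :=
  exists K : {fset nat},
    (match i with
     | 0 => max_largest [fset j in iota 0%N m.+1]%fset (lam k 0%N) (p_theta p) K
     | i'.+1 => max_largest (J k i') (lam k i)
                  (p_theta p * \sum_(j <- J k i') lam k i j) K
     end) /\
    J k i = ([fset 0%N; (m + i).+1] `|` K)%fset.

(* [trial] lists the successive values of \hat x: first the unperturbed point,
   then samples from B(x_k, sigma), B(x_k, sigma / 2), B(x_k, sigma / 4), etc. *)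
Definition trial (k i t : nat) : 'rV[R]_n :=
  match t with
  | 0 => x k
  | t'.+1 => x k + (p_sigma p / 2 ^+ t') *: u k i.+1 t'
  end.

Definition perturb_returns (k i : nat) (acc : R -> Prop) (y : 'rV[R]_n) : Prop :=
  exists t,
    let ok t' := diffset f (trial k i t' + dir k i) /\
                 acc (f (trial k i t' + dir k i) - f (x k)) in
    [/\ ok t, forall t', (t' < t)%N -> ~ ok t' & y = trial k i t + dir k i].

Definition FDP1_returns (k i : nat) : 'rV[R]_n -> Prop :=
  perturb_returns k i (fun r => r <= p_beta p * zval k i).

Definition FDP2_returns (k i : nat) : 'rV[R]_n -> Prop :=
  perturb_returns k i (fun r => p_beta p * zval k i < r).

Definition descent_test (k i : nat) : Prop :=
  f (x k + dir k i) - f (x k) <= p_beta p * zval k i.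

Definition enrich_test (k i : nat) : Prop :=
  lin_err k (m + i).+1 <= p_gamma p * aggr_e k i \/
  `|f (x k + dir k i) - f (x k)|
    <= 2^-1 * enorm (aggr_g k i) ^+ 2 + aggr_e k i.

(* [inner_entered k i]: within the outer iteration k, the run comes to the
   stopping test with inner counter i, and everything recorded in the trace for the steps
   executed so far in this outer iteration is what the algorithm prescribes. *)
Fixpoint inner_entered (k i : nat) : Prop :=
  match i with
  | 0 =>
    [/\ s k 0%N = x k /\
        (forall j, (j < m)%N -> s k j.+1 = x k + eps k *: u k 0%N j),
        forall j, (j <= m)%N -> diffset f (s k j),
        qp0_solution k (lam k 0%N) &
        index_set_ok k 0%N]
  | i'.+1 =>
    [/\ inner_entered k i',
        ~ (vval k i' <= 0) /\ ~ descent_test k i',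
        FDP2_returns k i' (s k (m + i').+1),
        enrich_test k i' &
        qp_solution k i' (lam k i) (tlam k i) /\ index_set_ok k i]
  end.

Definition serious_step (k i : nat) : Prop :=
  [/\ descent_test k i, FDP1_returns k i (x k.+1) & eps k.+1 = eps k].

Definition shrink_step (k i : nat) : Prop :=
  [/\ ~ descent_test k i, FDP2_returns k i (s k (m + i).+1),
      ~ enrich_test k i, eps k.+1 = p_mu p * eps k & x k.+1 = x k].

(* [outer_entered k]: the run starts the outer iteration k, and the
   trace agrees with the algorithm up to there. *)
Fixpoint outer_entered (k : nat) : Prop :=
  match k with
  | 0 => x 0%N = p_x0 p /\ eps 0%N = p_eps0 p
  | k'.+1 => outer_entered k' /\
      exists i, [/\ inner_entered k' i, ~ (vval k' i <= 0) &
                    serious_step k' i \/ shrink_step k' i]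
  end.

(* For a single realization this does not imply that x_k is a minimizer: draws that
   all lie in an unfavourable part of the ball can keep the aggregate constant.
   Hence the randomness below and an almost sure conclusion. *)
Definition inner_loop_infinite (k : nat) : Prop :=
  outer_entered k /\ forall i, inner_entered k i.

End Algorithm.

(* Lebesgue measure on R^n as an iterated integral. *)
Fixpoint vol (R : realType) (n : nat) : set 'rV[R]_n -> \bar R :=
  match n with
  | 0 => fun A => (\1_A (0 : 'rV[R]_0))%:E
  | n'.+1 => fun A =>
      (\int[@lebesgue_measure R]_(a in setT)
         vol [set y : 'rV[R]_n' | A (row_mx (a%:M : 'rV[R]_1) y)])%E
  end.

Definition unit_ball (R : realType) (n : nat) : set 'rV[R]_n :=
  [set y | enorm y <= 1].

Definition unif_ball (R : realType) (n : nat) (A : set 'rV[R]_n) : R :=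
  fine (vol (A `&` @unit_ball R n)) / fine (vol (@unit_ball R n)).

Definition borel (R : realType) (n : nat) : set (set 'rV[R]_n) :=
  <<s [set A : set 'rV[R]_n | open A] >>.

(* The draws are indexed by triples (k, a, t) as in [Algorithm] and are made in
   lexicographic order. *)
Definition draw_lt (k a t k' a' t' : nat) : Prop :=
  (k < k')%N \/ (k = k' /\ ((a < a')%N \/ (a = a' /\ (t < t')%N))).

(* [F k a t] is the information available just before the draw (k, a, t): the
   earlier draws, and possibly further randomness used by the algorithm when it
   selects among several minimizers or breaks ties.  "Sampled independently and
   uniformly" means that, given this information, a draw is uniform on the unit
   ball. *)
Definition uniform_draws (R : realType) (n : nat) (d : measure_display)
    (Omega : measurableType d) (P : probability Omega R)
    (F : nat -> nat -> nat -> set (set Omega))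
    (U : nat -> nat -> nat -> Omega -> 'rV[R]_n) : Prop :=
  [/\ forall k a t, sigma_algebra setT (F k a t) /\
                    F k a t `<=` (measurable : set (set Omega)),
      forall k a t k' a' t', draw_lt k a t k' a' t' ->
        F k a t `<=` F k' a' t',
      forall k a t k' a' t', draw_lt k a t k' a' t' ->
        forall A, borel A -> F k' a' t' (U k a t @^-1` A) &
      forall k a t E A, F k a t E -> borel A ->
        P (E `&` U k a t @^-1` A) = (P E * (unif_ball A)%:E)%E].

Definition meas_wrt (Omega Y : Type) (G : set (set Omega)) (S : set (set Y))
    (X : Omega -> Y) : Prop :=
  forall A, S A -> G (X @^-1` A).

(* A random trace is non-anticipating: every entry is a random variable depending
   only on the information available when the algorithm computes it. *)
Definition adapted (R : realType) (n : nat) (m : nat) (Omega : Type)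
    (F : nat -> nat -> nat -> set (set Omega)) (T : Omega -> bgs_trace R n) :
    Prop :=
  let bR := (measurable : set (set R)) in
  [/\ forall k, meas_wrt (F k 0%N 0%N) (@borel R n) (fun w => tr_x (T w) k) /\
                meas_wrt (F k 0%N 0%N) bR (fun w => tr_eps (T w) k),
      forall k j, (j <= m)%N ->
        meas_wrt (F k 1%N 0%N) (@borel R n) (fun w => tr_s (T w) k j),
      forall k i,
        meas_wrt (F k i.+2 0%N) (@borel R n) (fun w => tr_s (T w) k (m + i).+1),
      forall k i, (forall j, meas_wrt (F k i.+1 0%N) bR
                               (fun w => tr_lam (T w) k i j)) /\
                  meas_wrt (F k i.+1 0%N) bR (fun w => tr_tlam (T w) k i) &
      forall k i, meas_wrt (F k i.+1 0%N) setT (fun w => tr_J (T w) k i)].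

(* Main.v *)
Require Import Defs.
From HB Require Import structures.
From mathcomp Require Import all_boot all_order all_algebra finmap.
From mathcomp Require Import all_classical all_reals all_analysis.
From mathcomp Require Import measurable_realfun ring lra.

Set Implicit Arguments.
Unset Strict Implicit.
Unset Printing Implicit Defensive.

Import Order.TTheory GRing.Theory Num.Theory.
Import numFieldNormedType.Exports.

Local Open Scope classical_set_scope.
Local Open Scope ring_scope.

(** Fix an outer iteration whose inner loop never ends. Write x for its centre,
    tau for eps^alpha, g_i and e_i for the aggregate gradient and error, and
    W_i = |g_i|^2 / 2 + e_i / tau for the optimal value of the i-th quadratic problem.

    Suppose that f(y) < f(x) for some y. The affine function
    f(x) + <g_i, . - x> - e_i lies below f, so g_i and e_i cannot both be small, and
    W_i stays above some w0 > 0 ([bundle_obj_bounded_below]). On the other hand the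
    next quadratic problem may use the whole segment from the aggregate to the pair
    of the newest auxiliary point ([bundle_obj_segment]), and the failure of the
    descent test makes W drop by a fixed amount along this segment, provided that
    the auxiliary point is close to the target x + d_i ([good_step_decrease]).
    Infinitely many such steps contradict W >= 0.

    The perturbation routine returns the target itself if f is differentiable
    there. Otherwise its first random trial is x + d_i + sigma u, where u is uniform
    on the unit ball. Call u good if it is small, if f does not decrease from the
    target to this trial, and if f has no kink there in a coordinate direction
    ([good_draw]). A convex function without kinks at a point is differentiable
    there ([no_kink_differentiable]), so a good trial is accepted ([fdp2_good]).
    Given the past, a draw is good with a probability bounded below by a positive
    constant ([unif_good_draw]): by convexity f does not decrease towards u or
    towards -u, and kinks have probability zero. Hence, almost surely, good draws
    occur infinitely often, for every size in a sequence that tends to 0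
    ([recurrence], [good_draws_recur]).

    Three devices keep the measure theory elementary. First, [unif_ball] is the law
    of a draw, hence a measure; of [vol] one only needs the volume of a cube and the
    invariance under translations and reflection, which hold for the integral of an
    arbitrary nonnegative function. Secondly, kinks are null because many translates
    of the set of kinks along a coordinate axis overlap only boundedly often
    ([kink_count], [unif_kink_draw]), which replaces a disintegration along lines.
    Thirdly, the target depends on the past and the draw does not, so their joint
    law is a product ([draw_freezing]); for this the target is rewritten as a Borel
    function of the trace ([borel_target]). *)

(** * Row vectors and the Euclidean inner product *)
Section RowVectors.
Context (R : realType) (n : nat).
Implicit Types v w : 'rV[R]_n.

Lemma normr_coord_le v j : `|v 0 j| <= `|v|.
Proof.
by rewrite [leRHS]/Num.norm/= mx_normrE; apply: (le_bigmax _ (fun i => `|v i.1 i.2|) (0, j)).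
Qed.

Lemma normr_le_coord v (r : R) : 0 <= r -> (forall j, `|v 0 j| <= r) -> `|v| <= r.
Proof.
move=> r0 vr; rewrite [leLHS]/Num.norm/= mx_normrE; apply/bigmax_leP; split => //.
by move=> [i j] _ /=; rewrite ord1.
Qed.

Lemma normr_delta_le j : `|delta_mx 0 j : 'rV[R]_n| <= 1.
Proof.
by apply: normr_le_coord => // i; rewrite mxE; case: eqP; case: eqP => //=; rewrite ?normr1 ?normr0.
Qed.
End RowVectors.

Section Dot.
Context (R : realType) (n : nat).
Implicit Types (x y z : 'rV[R]_n) (a : R).

Lemma dotvC x y : dotv x y = dotv y x.
Proof. by apply: eq_bigr => i _; rewrite mulrC. Qed.

Lemma dotvDl x y z : dotv (x + y) z = dotv x z + dotv y z.
Proof. by rewrite -big_split; apply: eq_bigr => i _; rewrite mxE mulrDl. Qed.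

Lemma dotvZl a x z : dotv (a *: x) z = a * dotv x z.
Proof. by rewrite /dotv mulr_sumr; apply: eq_bigr => i _; rewrite mxE mulrA. Qed.

Lemma dotvDr x y z : dotv x (y + z) = dotv x y + dotv x z.
Proof. by rewrite dotvC dotvDl !(dotvC x). Qed.

Lemma dotvZr a x z : dotv x (a *: z) = a * dotv x z.
Proof. by rewrite dotvC dotvZl dotvC. Qed.

Lemma dotvNl x z : dotv (- x) z = - dotv x z.
Proof. by rewrite -scaleN1r dotvZl mulN1r. Qed.

Lemma dotvNr x z : dotv x (- z) = - dotv x z.
Proof. by rewrite dotvC dotvNl dotvC. Qed.

Lemma dotv0l z : dotv 0 z = 0.
Proof. by rewrite -(scale0r z) dotvZl mul0r. Qed.

Lemma dotv_suml I (s : seq I) (P : pred I) (F : I -> 'rV[R]_n) z :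
  dotv (\sum_(i <- s | P i) F i) z = \sum_(i <- s | P i) dotv (F i) z.
Proof.
by apply: (big_morph (fun x => dotv x z)) => [x y|]; rewrite ?dotvDl ?dotv0l. Qed.

Lemma dotv_delta x j : dotv x (delta_mx 0 j) = x 0 j.
Proof.
rewrite /dotv (bigD1 j) //= mxE !eqxx mulr1 big1 ?addr0 // => i ij.
by rewrite mxE (negbTE ij) andbF mulr0.
Qed.

Lemma dotv_ge0 x : 0 <= dotv x x.
Proof. by apply: sumr_ge0 => i _; rewrite -expr2 sqr_ge0. Qed.

Lemma enorm_sqr x : enorm x ^+ 2 = dotv x x.
Proof. by rewrite sqr_sqrtr // dotv_ge0. Qed.

Lemma dotv_norm_le x y (c : R) : (forall j, `|x 0 j| <= c) ->
  `|dotv x y| <= n%:R * c * `|y|.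
Proof.
move=> xc; rewrite (le_trans (ler_norm_sum _ _ _)) //.
rewrite -[n in n%:R]card_ord -mulrA mulr_natl -sumr_const ler_sum // => i _.
by rewrite normrM ler_pM // normr_coord_le.
Qed.
End Dot.

(** * Convex functions *)
Section Convex.
Context (R : realType) (n : nat) (f : 'rV[R]_n -> R).
Hypothesis hf : convex_function (setT : set 'rV[R]_n) f.
Implicit Types x y v : 'rV[R]_n.
Local Notation e j := (delta_mx 0 j : 'rV[R]_n).

Lemma convex_le (t : R) x y : 0 <= t <= 1 ->
  f (t *: x + (1 - t) *: y) <= t * f x + (1 - t) * f y.
Proof.
move=> /andP[t0 t1].
exact: (hf (Itv01 t0 t1) (in_setT x) (in_setT y)).
Qed.

Lemma convex_scale (t : R) x v : 0 <= t <= 1 ->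
  f (x + t *: v) - f x <= t * (f (x + v) - f x).
Proof.
move=> t01; have := convex_le (x + v) x t01.
rewrite (_ : _ + _ *: x = x + t *: v); first by lra.
by apply/rowP => i; rewrite !mxE; ring.
Qed.

Lemma convex_mid x v : f x *+ 2 <= f (x + v) + f (x - v).
Proof.
have h : 0 <= (2^-1 : R) <= 1 by lra.
have := convex_le (x + v) (x - v) h.
rewrite (_ : _ + _ *: (x - v) = x); first by move=> H; lra.
by apply/rowP => i; rewrite !mxE; field.
Qed.

Lemma convex_mean N (p : 'I_N.+1 -> 'rV[R]_n) :
  f (N.+1%:R^-1 *: \sum_i p i) <= N.+1%:R^-1 * \sum_i f (p i).
Proof.
elim: N p => [|N IHN] p; first by rewrite !big_ord1 invr1 scale1r mul1r.
rewrite big_ord_recr [in leRHS]big_ord_recr /=.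
set P := \sum_i _; set S := \sum_i _.
have N1 : (N.+1%:R : R) != 0 by rewrite pnatr_eq0.
have N2 : (N.+2%:R : R) != 0 by rewrite pnatr_eq0.
have N2E : (N.+2%:R : R) = N.+1%:R + 1 by rewrite -natr1.
have N1p : 0 < (N.+1%:R : R) by rewrite ltr0n.
have N2p : 0 < (N.+2%:R : R) by rewrite ltr0n.
have t01 : 0 <= (N.+1%:R / N.+2%:R : R) <= 1.
  by rewrite divr_ge0 //= ler_pdivrMr // mul1r N2E lerDl.
have := convex_le (N.+1%:R^-1 *: P) (p ord_max) t01.
have -> : 1 - N.+1%:R / N.+2%:R = N.+2%:R^-1 :> R.
  by rewrite -[X in X - _](divff N2) -mulrBl N2E addrAC subrr add0r mul1r.
rewrite scalerA mulrAC divff // mul1r -scalerDr => /le_trans; apply.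
rewrite [leRHS]mulrDr lerD2r.
have := IHN (fun i => p (widen_ord (leqnSn N.+1) i)); rewrite -/P -/S => PS.
have := ler_wpM2l (ltW N1p) PS; rewrite mulrA divff // mul1r => {}PS.
by rewrite mulrC mulrA [leRHS]mulrC ler_pM2r ?invr_gt0 // mulrC.
Qed.

Lemma rV_sum_delta v : v = \sum_j v 0 j *: e j.
Proof. exact: row_sum_delta. Qed.

(** The point [x + v] is the mean of the points [x + n v_j e_j], so that bounds along
    the coordinate axes give bounds everywhere. *)
Lemma convex_axes x v : (0 < n)%N ->
  f (x + v) <= n%:R^-1 * \sum_j f (x + (n%:R * v 0 j) *: e j).
Proof.
case: n f hf x v convex_mean => // m g hg x v cm _.
apply: le_trans (cm _ _); rewrite le_eqVlt; apply/orP; left; apply/eqP; congr g.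
have m1 : (m.+1%:R : R) != 0 by rewrite pnatr_eq0.
rewrite big_split /= sumr_const card_ord scalerDr.
rewrite -[X in _ = _ *: X + _]scaler_nat scalerA mulVf // scale1r; congr (_ + _).
rewrite [LHS]row_sum_delta scaler_sumr; apply: eq_bigr => j _.
by rewrite scalerA mulrA mulVf // mul1r.
Qed.

(** The mean over the axes bounds [f] from above; the midpoint inequality between
    [v] and [- v] turns this into a bound from below. *)
Lemma convex_bounded (r : R) : 0 < r ->
  exists M : R, 0 < M /\ forall v, `|v| <= r -> `|f v| <= M.
Proof.
move=> r0; have [n0|n0] := posnP n.
  exists (`|f 0| + 1); split; first by rewrite ltr_pwDr.
  move=> v _; have -> : v = 0 by apply/rowP => j; have := ltn_ord j; rewrite [X in (_ < X)%N]n0.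
  by rewrite lerDl.
pose B := \sum_j (`|f ((n%:R * r) *: e j)| + `|f (- (n%:R * r) *: e j)|).
have B0 : 0 <= B by apply: sumr_ge0 => j _; rewrite addr_ge0.
have nr : 0 < n%:R * r by rewrite mulr_gt0 // ltr0n.
have up v : `|v| <= r -> f v <= B.
  move=> vr; have := convex_axes 0 v n0; rewrite add0r => /le_trans; apply.
  rewrite ler_pdivrMl ?ltr0n //.
  have step (j : 'I_n) : f (0 + (n%:R * v 0 j) *: e j) <= B.
    rewrite add0r.
    have vj : `|v 0 j| <= r by apply: le_trans vr; exact: normr_coord_le.
    pose t := (v 0 j + r) / (r *+ 2).
    have r2 : 0 < r *+ 2 by rewrite pmulrn_lgt0.
    have t01 : 0 <= t <= 1.
      move: vj; rewrite ler_norml => /andP[v1 v2].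
      by rewrite divr_ge0 ?(ltW r2) /= ?ler_pdivrMr // ?mul1r ?mulr2n; lra.
    have := convex_le ((n%:R * r) *: e j) (- (n%:R * r) *: e j) t01.
    rewrite !scalerA -scalerDl (_ : t * _ + _ = n%:R * v 0 j); last first.
      by rewrite /t; field; rewrite gt_eqF.
    move/le_trans; apply; rewrite /B (bigD1 j) //=.
    rewrite -[leLHS]addr0 lerD //; last by apply: sumr_ge0 => i _; rewrite addr_ge0.
    case/andP: t01 => t0 t1.
    by apply: lerD; [rewrite (le_trans (ler_norm _))// normrM ger0_norm // ler_piMl
      |rewrite (le_trans (ler_norm _))// normrM ger0_norm ?subr_ge0// ler_piMl// gerBl].
  rewrite (le_trans (ler_sum _ (fun j _ => step j))) // sumr_const card_ord.
  by rewrite mulr_natl.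
exists (B + 2 * `|f 0| + 1); split; first by rewrite ltr_pwDr // addr_ge0 // mulr_ge0.
move=> v vr; rewrite ler_norml.
have := up _ vr; have := up (- v); rewrite normrN => /(_ vr).
have := convex_mid 0 v; rewrite !add0r mulr2n.
have := ler_norm (f 0); have := ler_norm (- f 0); rewrite normrN; lra.
Qed.

(** Prolong the segment from [b] to [a] by a unit length: [f] is still bounded at the
    end point [z], and the slope from [b] to [a] is at most the one from [b] to [z]. *)
Lemma convex_lipschitz (r : R) : 0 < r -> exists L : R, 0 < L /\
  forall a b, `|a| <= r -> `|b| <= r -> `|f a - f b| <= L * `|a - b|.
Proof.
move=> r0.
have [M [M0 Mf]] := convex_bounded (addr_gt0 r0 ltr01).
exists (2 * M); split; first by rewrite mulr_gt0.
have half a b : `|a| <= r -> `|b| <= r -> f a - f b <= 2 * M * `|a - b|.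
  move=> ar br; have [->|ab] := eqVneq a b.
    by rewrite !subrr normr0 mulr0.
  have d0 : 0 < `|a - b| by rewrite normr_gt0 subr_eq0.
  set d := `|a - b| in d0 *.
  have dn : d != 0 by rewrite gt_eqF.
  have d1n : d + 1 != 0 by rewrite gt_eqF // ltr_wpDr.
  (* The distance from [a] to [z] is 1. *)
  pose z := a + d^-1 *: (a - b).
  have zr : `|z| <= r + 1.
    rewrite (le_trans (ler_normD _ _)) // lerD // normrZ normfV.
    by rewrite [X in X^-1 * _]gtr0_norm // mulVf.
  pose t := d / (d + 1).
  have t01 : 0 <= t <= 1.
    rewrite divr_ge0 ?addr_ge0 ?(ltW d0) //=.
    by rewrite ler_pdivrMr ?ltr_wpDr ?(ltW d0) // mul1r lerDl.
  have := convex_le z b t01.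
  rewrite (_ : _ + _ *: b = a); last first.
    by apply/rowP => i; rewrite !mxE /t; field; rewrite dn d1n.
  have := Mf _ zr; have : `|b| <= r + 1 by rewrite (le_trans br) // lerDl.
  move=> /Mf; rewrite !ler_norml => /andP[b1 b2] /andP[z1 z2] fa.
  have fab : f a - f b <= t * (f z - f b) by lra.
  apply: le_trans fab _.
  have fzb : f z - f b <= 2 * M by lra.
  case/andP: t01 => t0 t1.
  apply: (le_trans (ler_wpM2l t0 fzb)); rewrite mulrC ler_pM2l ?mulr_gt0 //.
  by rewrite ler_pdivrMr ?ltr_wpDr ?(ltW d0) // mulrDr mulr1 lerDr mulr_ge0 // ltW.
move=> a b ar br; rewrite ler_norml half // andbT.
by rewrite lerNl opprB distrC half.
Qed.

Lemma convex_continuous : continuous (f : 'rV[R]_n -> R^o).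
Proof.
move=> x.
have x0 : 0 < `|x| + 1 by rewrite ltr_wpDl.
have [L [L0 Lf]] := convex_lipschitz x0.
apply/(@cvgrPdist_le _ R^o _ (nbhs x)) => eps eps0.
near=> y.
rewrite (le_trans (Lf _ _ _ _)) ?lerDl //.
  have -> : y = x - (x - y) by rewrite subKr.
  rewrite (le_trans (ler_normB _ _)) // lerD2l.
  by near: y; apply: cvgr_dist_le.
rewrite mulrC -ler_pdivlMr //; near: y; apply: cvgr_dist_le => //.
by rewrite divr_gt0.
Unshelve. all: by end_near. Qed.

Lemma convex_shift_continuous v : continuous (fun z : 'rV[R]_n => f (z + v) : R^o).
Proof.
move=> y; apply: (@continuous_comp _ _ _ (fun z : 'rV[R]_n => z + v) (f : _ -> R^o)).
  by apply: (@cvgD _ 'rV[R]_n _ (nbhs y)); [exact: cvg_id|exact: cvg_cst].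
exact: convex_continuous.
Qed.

Lemma derive_dotv x v : diffset f x -> 'D_v (f : 'rV[R]_n -> R^o) x = dotv (grad f x) v.
Proof.
move=> dx; rewrite deriveE // [v in LHS]rV_sum_delta raddf_sum /=.
by apply: eq_bigr => j _; rewrite linearZ /= mxE -deriveE // mulrC.
Qed.

Lemma grad_cvg x v : diffset f x ->
  (fun N => N.+1%:R * (f (x + N.+1%:R^-1 *: v) - f x)) @ \oo --> dotv (grad f x) v.
Proof.
move=> dx; have := @diff_derivable _ _ _ (f : 'rV[R]_n -> R^o) x v dx.
rewrite -derive_dotv // => /cvg_ex[l fl].
have -> : 'D_v (f : 'rV[R]_n -> R^o) x = l by apply: cvg_lim.
have h0 : (fun N => N.+1%:R^-1 : R) @ \oo --> (0 : R)^'.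
  move=> A [eps /= eps0 epsA]; have := @cvg_harmonic R.
  move=> /cvgrPdist_lt/(_ _ eps0) [N _ HN]; exists N => // m /HN /= mN.
  by apply: epsA => //=; rewrite invr_eq0 pnatr_eq0.
have := cvg_comp _ _ h0 fl; apply: cvg_trans; apply: near_eq_cvg; near=> N.
by rewrite /= invrK [_ + x]addrC.
Unshelve. all: by end_near. Qed.

(** By convexity the difference quotients of [f] from [x] towards [y] are at most
    [f y - f x]. *)
Lemma grad_ineq x y : diffset f x -> f x + dotv (grad f x) (y - x) <= f y.
Proof.
move=> dx; rewrite -lerBrDl.
apply: (cvgr_to_le (@grad_cvg x (y - x) dx)).
apply: nearW => N; rewrite mulrC -ler_pdivlMr ?ltr0n // [leRHS]mulrC.
have := @convex_scale N.+1%:R^-1 x (y - x).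
rewrite (addrC x (y - x)) subrK; apply.
by rewrite invr_ge0 ler0n /= invf_le1 ?ler1n ?ltr0n.
Qed.

(** The gradient inequality at the points [x + e j] and [x - e j] bounds the partial
    derivative from both sides by increments of [f]. *)
Lemma grad_bounded (r : R) : 0 < r -> exists C : R, 0 < C /\
  forall x, diffset f x -> `|x| <= r -> forall j, `|grad f x 0 j| <= C.
Proof.
move=> r0; have [M [M0 fM]] := convex_bounded (addr_gt0 r0 ltr01).
exists (2 * M); split=> [|x dx xr j]; first by rewrite mulr_gt0.
have near1 v : `|v| <= 1 -> dotv (grad f x) v <= 2 * M.
  move=> v1; have := grad_ineq (x + v) dx; rewrite (addrC x v) addrK.
  have : `|v + x| <= r + 1 by rewrite (le_trans (ler_normD _ _)) // addrC lerD.
  have xr1 : `|x| <= r + 1 by rewrite (le_trans xr) // lerDl.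
  by move/fM: xr1 => /ler_normlP[? ?] /fM/ler_normlP[? ?]; lra.
have d1 := normr_delta_le R j.
rewrite -dotv_delta ler_norml near1 // andbT lerNl -dotvNr near1 //.
by rewrite normrN.
Qed.

(** The points at which the right and left slopes of [f] along [e j] differ by at
    least [1 / (q + 1)]. By convexity the quotient of the second difference by [h]
    decreases to the jump of the slope when [h] decreases to 0, so that the
    inequality for all [h] expresses a bound on this jump by a closed condition. *)
Definition kink (j : 'I_n) (q : nat) : set 'rV[R]_n :=
  [set y | forall h, 0 < h ->
     h / q.+1%:R <= f (y + h *: e j) + f (y - h *: e j) - f y *+ 2].

Lemma closed_kink j q : closed (kink j q).
Proof.
pose g h := fun y : 'rV[R]_n => f (y + h *: e j) + f (y - h *: e j) - f y *+ 2 : R^o.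
have -> : kink j q =
    \bigcap_(h in [set h : R | 0 < h]) (g h @^-1` [set z : R^o | h / q.+1%:R <= z]).
  by apply/seteqP; split => y.
apply: closed_bigI => h _; apply: closed_comp; last exact: closed_ge.
move=> y _; have -> : g h = fun y => f (y + h *: e j) + f (y - h *: e j) - (f y + f y).
  by apply/funext => z; rewrite /g mulr2n.
apply: (@cvgB _ R^o _ (nbhs y)); apply: (@cvgD _ R^o _ (nbhs y)); try exact: convex_continuous.
  exact: convex_shift_continuous.
exact: (@convex_shift_continuous (- (h *: e j))).
Qed.

(** The second differences of [f] at equally spaced points of a line are nonnegative
    and sum up to a difference of two increments of [f], which the Lipschitz
    constant controls; each kink contributes at least [h / (q + 1)]. The resulting
    bound on the number of kinks does not depend on [M]. *)
Lemma kink_count j q (r L h : R) y M : 0 < h -> 0 <= L ->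
  (forall a b, `|a| <= r -> `|b| <= r -> `|f a - f b| <= L * `|a - b|) ->
  (forall t, - h <= t <= M%:R * h -> `|y - t *: e j| <= r) ->
  \sum_(m < M) \1_(kink j q) (y - (m%:R * h) *: e j) <= L * q.+1%:R *+ 2.
Proof.
move=> h0 L0 fL yr.
(* The shift by [h] starts the sequence one step before the first point. *)
pose b m := f (y - (m%:R * h - h) *: e j).
have bL m : (m <= M)%N -> `|b m.+1 - b m| <= L * h.
  move=> mM; rewrite /b; have mM' : m%:R * h <= M%:R * h :> R.
    by rewrite ler_pM2r // ler_nat.
  have mh0 : 0 <= m%:R * h by rewrite mulr_ge0 // ltW.
  have -> : m.+1%:R * h - h = m%:R * h by rewrite -natr1; ring.
  rewrite (le_trans (fL _ _ _ _)) //; try by apply: yr; lra.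
  rewrite (_ : _ - _ - _ = (- h) *: e j); last by apply/rowP => i; rewrite !mxE; ring.
  rewrite normrZ normrN gtr0_norm // ler_wpM2l // -[leRHS]mulr1.
  by rewrite ler_wpM2l ?(ltW h0) // normr_delta_le.
have step (m : 'I_M) : \1_(kink j q) (y - (m%:R * h) *: e j) * (h / q.+1%:R) <=
    (b m.+2 - b m.+1) - (b m.+1 - b m).
  have -> : b m = f (y - (m%:R * h) *: e j + h *: e j).
    by rewrite /b; congr f; apply/rowP => i; rewrite !mxE; ring.
  have -> : b m.+1 = f (y - (m%:R * h) *: e j).
    by rewrite /b -natr1; congr f; apply/rowP => i; rewrite !mxE; ring.
  have -> : b m.+2 = f (y - (m%:R * h) *: e j - h *: e j).
    by rewrite /b -natr1 -natr1; congr f; apply/rowP => i; rewrite !mxE; ring.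
  rewrite indicE; case: (boolP (_ \in _)) => [/set_mem /(_ _ h0)|_] /=.
    by rewrite mulr1n mul1r; set X := h / _; lra.
  by rewrite mul0r; have := convex_mid (y - (m%:R * h) *: e j) (h *: e j); lra.
have hq : 0 < h / q.+1%:R by rewrite divr_gt0.
rewrite -(ler_pM2r hq) mulr_suml (le_trans (ler_sum _ (fun m _ => step m))) //.
rewrite (eq_bigr (fun m : 'I_M => (fun k => b k.+1 - b k) m.+1 - (fun k => b k.+1 - b k) m)) //.
rewrite -(big_mkord xpredT (fun m => (fun k => b k.+1 - b k) m.+1 - (fun k => b k.+1 - b k) m)).
rewrite telescope_sumr //.
have -> : (L * q.+1%:R *+ 2) * (h / q.+1%:R) = L * h + L * h.
  by have : (q.+1%:R : R) != 0; [rewrite pnatr_eq0 | set Q : R := q.+1%:R => Qn; field].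
by have := bL M (leqnn _); have := bL 0%N (leq0n _); rewrite !ler_norml => /andP[? ?] /andP[? ?]; lra.
Qed.

(** The infimum [g] of the right slopes separates the left slopes from the right ones,
    hence the distance of each increment to its linear part is at most a second
    difference, which is small without kinks. *)
Lemma no_kink_slope j y : (forall q, ~ kink j q y) -> exists g : R,
  forall eta, 0 < eta -> exists2 h0 : R, 0 < h0 &
    forall t, `|t| <= h0 -> f (y + t *: e j) - f y - t * g <= eta * `|t|.
Proof.
move=> nk.
pose S := [set s : R | exists2 h, 0 < h & s = (f (y + h *: e j) - f y) / h].
have lbS t : 0 < t -> lbound S ((f y - f (y - t *: e j)) / t).
  move=> t0 _ [h h0 ->].
  have ht : 0 < h + t by rewrite addr_gt0.
  have htn : h + t != 0 by rewrite gt_eqF.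
  have w01 : 0 <= h / (h + t) <= 1.
    by rewrite divr_ge0 ?(ltW h0) ?(ltW ht) //= ler_pdivrMr // mul1r lerDl ltW.
  have := convex_le (y - t *: e j) (y + h *: e j) w01.
  rewrite (_ : _ *: (y - _) + _ = y); last by apply/rowP => i; rewrite !mxE; field.
  have -> : 1 - h / (h + t) = t / (h + t) by field.
  rewrite mulrAC [X in _ + X]mulrAC -mulrDl ler_pdivlMr // => H.
  by rewrite ler_pdivrMr // mulrAC ler_pdivlMr //; lra.
have infS : has_inf S.
  split; first by exists ((f (y + 1 *: e j) - f y) / 1); exists 1.
  by eexists; exact: (lbS 1).
exists (inf S) => eta eta0.
have gr t : 0 < t -> t * inf S <= f (y + t *: e j) - f y.
  by move=> t0; rewrite mulrC -ler_pdivlMr //; apply: ge_inf; [case: infS|exists t].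
have gl t : 0 < t -> f y - f (y - t *: e j) <= t * inf S.
  by move=> t0; rewrite mulrC -ler_pdivrMr //; apply: lb_le_inf; [case: infS|exact: lbS].
have [q qeta] : exists q : nat, q.+1%:R^-1 <= eta.
  have [q] := ltr_add_invr eta0; rewrite add0r => /ltW.
  by exists q.
have [h0 h00 Dh] : exists2 h, 0 < h &
    f (y + h *: e j) + f (y - h *: e j) - f y *+ 2 < h / q.+1%:R.
  apply: contrapT => H; apply: (nk q) => h hp; rewrite leNgt; apply/negP => H'.
  by apply: H; exists h.
exists h0 => // t th0.
have D s : 0 < s <= h0 -> f (y + s *: e j) + f (y - s *: e j) - f y *+ 2 <= eta * s.
  move=> /andP[s0 sh].
  have w01 : 0 <= s / h0 <= 1.
    by rewrite divr_ge0 ?(ltW s0) ?(ltW h00) //= ler_pdivrMr // mul1r.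
  have h0n : h0 != 0 by rewrite gt_eqF.
  have := convex_scale y (h0 *: e j) w01.
  have := convex_scale y (- (h0 *: e j)) w01.
  rewrite scalerN !scalerA divfK //.
  set p := f (y + s *: e j); set m := f (y - s *: e j).
  set P := f (y + h0 *: e j) in Dh *; set N := f (y - h0 *: e j) in Dh * => H1 H2.
  have : s / h0 * (P + N - f y *+ 2) <= s / h0 * (h0 / q.+1%:R).
    by rewrite ler_wpM2l ?(ltW Dh) //; case/andP: w01.
  rewrite mulrA divfK // => H3.
  have : s / q.+1%:R <= eta * s by rewrite mulrC ler_pM2r.
  move: H1 H2 H3; set w := s / h0; set X := s / q.+1%:R; set Y := eta * s.
  lra.
case: (ltrgt0P t) th0 => [t0 th|t0 th|-> _]; last first.
- by rewrite scale0r addr0 mul0r mulr0 !subrr.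
- have t0' : 0 < - t by rewrite oppr_gt0.
  have := D (- t); rewrite t0' th scaleNr opprK => /(_ isT).
  by have := gr _ t0'; rewrite scaleNr; lra.
- have := D t; rewrite t0 th => /(_ isT).
  by have := gl _ t0; lra.
Qed.

(** The remainder [phi] of the linear approximation is convex. It is at most the mean
    of its values along the axes, which [no_kink_slope] makes small, and it is at
    least the opposite of its value at the reflected point. *)
Lemma no_kink_differentiable y : (forall j q, ~ kink j q y) -> diffset f y.
Proof.
move=> nk.
have [n0|n0] := posnP n.
  have -> : f = cst (f 0).
    apply/funext => z; congr f; apply/rowP => j.
    by have := ltn_ord j; rewrite [X in (_ < X)%N]n0.
  exact: differentiable_cst.
have [g gP] := choice (fun j => no_kink_slope (nk j)).
pose G : 'rV[R]_n := \row_j g j.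
pose phi v := f (y + v) - f y - dotv G v.
have phiP eta : 0 < eta -> exists2 r : R, 0 < r & forall v, `|v| <= r -> `|phi v| <= eta * `|v|.
  move=> eta0.
  have nn : 0 < (n%:R : R) by rewrite ltr0n.
  have en : 0 < eta / n%:R by rewrite divr_gt0.
  have /choice[h hP] : forall j, exists h : R, 0 < h /\ forall t, `|t| <= h ->
      f (y + t *: e j) - f y - t * g j <= eta / n%:R * `|t|.
    by move=> j; have [h h0 H] := gP j _ en; exists h.
  have [r0 [r00 r0h]] : exists r0, 0 < r0 /\ forall j, r0 <= h j.
    exists (\big[Order.min/1]_j h j); split.
      by apply/bigmin_gtP; split => // j _; case: (hP j).
    by move=> j; exact: bigmin_le_cond.
  have up v : `|v| <= r0 / n%:R -> phi v <= eta * `|v|.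
    move=> vr; rewrite /phi.
    have axis j : f (y + (n%:R * v 0 j) *: e j) - f y - n%:R * v 0 j * g j <= eta * `|v|.
      have vj : `|n%:R * v 0 j| <= n%:R * `|v|.
        by rewrite normrM ger0_norm ?ler0n // ler_pM2l // normr_coord_le.
      have [_ /(_ (n%:R * v 0 j))] := hP j.
      move=> H; apply: le_trans (H _) _.
        rewrite (le_trans vj) // (le_trans _ (r0h j)) // mulrC -ler_pdivlMr //.
      by rewrite (le_trans (ler_wpM2l (ltW en) vj)) // mulrA divfK ?gt_eqF.
    have := convex_axes y v n0.
    have -> : \sum_j f (y + (n%:R * v 0 j) *: e j) =
      \sum_j (f (y + (n%:R * v 0 j) *: e j) - f y - n%:R * v 0 j * g j) + n%:R * (f y + dotv G v).
      have -> : n%:R * (f y + dotv G v) = \sum_j (f y + n%:R * (v 0 j * g j)).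
        rewrite big_split /= sumr_const card_ord mulrDr -[f y *+ n]mulr_natl.
        rewrite /dotv mulr_sumr; congr (_ + _); apply: eq_bigr => j _.
        by rewrite mxE [g j * _]mulrC.
      by rewrite -big_split /=; apply: eq_bigr => j _; ring.
    rewrite mulrDr mulKf ?gt_eqF // => H.
    have : n%:R^-1 * \sum_j (f (y + (n%:R * v 0 j) *: e j) - f y - n%:R * v 0 j * g j) <= eta * `|v|.
      rewrite ler_pdivrMl // (le_trans (ler_sum _ (fun j _ => axis j))) //.
      by rewrite sumr_const card_ord mulr_natl.
    lra.
  exists (r0 / n%:R); first by rewrite divr_gt0.
  move=> v vr; rewrite ler_norml up // andbT.
  have := up (- v); rewrite normrN => /(_ vr); rewrite /phi dotvNr.
  by have := convex_mid y v; lra.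
pose df : 'rV[R]_n -> R^o := dotv G.
have dflin : linear df by move=> a u v; rewrite /df dotvDr dotvZr.
pose dfL : {linear 'rV[R]_n -> R^o} := HB.pack df (GRing.isLinear.Build _ _ _ _ _ dflin).
have dfc : continuous dfL.
  move=> z; apply/(@cvgrPdist_le R R^o _ (nbhs z)) => eps eps0.
  pose c := n%:R * `|G| + 1.
  have c0 : 0 < c by rewrite ltr_wpDl // mulr_ge0.
  near=> w; rewrite /= /df -dotvNr -dotvDr.
  have := @dotv_norm_le _ _ G (z - w) `|G| (fun j => normr_coord_le G j).
  move=> /le_trans; apply; apply: (@le_trans _ _ (c * `|z - w|)).
    by rewrite ler_wpM2r // /c lerDl.
  rewrite mulrC -ler_pdivlMr //; near: w; apply: cvgr_dist_le => //.
  by rewrite divr_gt0.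
have E : (f : _ -> R^o) \o shift y = cst (f y : R^o) + dfL +o_ (0 : 'rV[R]_n) id.
  apply/eqaddoP => eps eps0; have [r r0 rP] := phiP _ eps0.
  have nr : \forall v \near (0 : 'rV[R]_n), `|v| <= r.
    by apply/nbhs_normP; exists r => //= w /=; rewrite sub0r normrN => /ltW.
  apply: filterS nr => v /rP; rewrite /phi; congr (`|_| <= _).
  by rewrite -[RHS]/(f (v + y) - (f y + dotv G v)) [v + y]addrC opprD addrA.
have dE := diff_unique dfc E.
by apply/diff_locallyP; rewrite dE.
Unshelve. all: by end_near. Qed.
End Convex.

(** * Invariance of the volume *)
Section ShiftInvariance.
Context (R : realType).
Local Notation mu := (@lebesgue_measure R).
Local Notation TR := (measurableTypeR R).
Import HBNNSimple.

(** The function [g] is arbitrary, since [vol] integrates over the sections of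
    arbitrary sets: composing with [phi] maps the simple functions below [g] to
    simple functions below [g \o phi] with the same integral. *)
Lemma integral_comp_le (phi psi : TR -> TR) (g : TR -> \bar R) :
  measurable_fun setT phi -> cancel psi phi ->
  (forall A, measurable A -> mu (phi @^-1` A) = mu A) ->
  (forall x, 0 <= g x)%E ->
  (\int[mu]_x g x <= \int[mu]_x g (phi x))%E.
Proof.
move=> mphi psiK muphi g0.
rewrite !ge0_integralTE//; apply: ge_ereal_sup => _ [h /= hg <-].
apply: ereal_sup_ubound => /=.
have mh : measurable_fun setT (h \o phi) by exact: measurableT_comp.
have fh : finite_set (range (h \o phi)).
  by apply: sub_finite_set (@fimfunP _ _ h) => _ [x _ <-]; exists (phi x).
have h0 x : 0 <= (h \o phi) x by exact: fun_ge0.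
pose k : {nnsfun TR >-> R} := HB.pack (h \o phi)
  (isMeasurableFun.Build _ _ _ _ _ mh) (FiniteImage.Build _ _ _ fh)
  (isNonNegFun.Build _ _ _ h0).
exists k; first by move=> x; exact: hg.
rewrite !sintegralET; apply: eq_fsbigr => x _; congr (_ * _)%E.
rewrite -[RHS]muphi //.
Qed.

Lemma integral_comp (phi psi : TR -> TR) (g : TR -> \bar R) :
  measurable_fun setT phi -> measurable_fun setT psi ->
  cancel psi phi -> cancel phi psi ->
  (forall A, measurable A -> mu (phi @^-1` A) = mu A) ->
  (forall x, 0 <= g x)%E ->
  (\int[mu]_x g (phi x) = \int[mu]_x g x)%E.
Proof.
move=> mphi mpsi psiK phiK muphi g0; apply/eqP; rewrite eq_le.
rewrite (integral_comp_le mphi psiK) // andbT.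
rewrite (le_trans (integral_comp_le mpsi phiK _ _)) //.
  move=> A mA; have mB : measurable (psi @^-1` A).
    by rewrite -[X in measurable X]setTI; exact: mpsi.
  have -> : A = phi @^-1` (psi @^-1` A).
    by apply/funext => x /=; rewrite /preimage /= phiK.
  by rewrite [RHS]muphi //; congr (mu _); apply/funext => x; rewrite /preimage /= phiK.
by under eq_integral do rewrite psiK.
Qed.

Lemma lebesgue_measure_shift (a : R) (A : set TR) : measurable A ->
  mu [set x | A (x + a)] = mu A.
Proof.
move=> mA.
have ma : measurable_fun setT (fun x : TR => x + a : TR) by exact: measurable_funD.
transitivity (pushforward mu (fun x : TR => x + a : TR) A) => //.
apply/esym.
apply: lebesgue_measure_unique => //= _ [[c d]] _ <-.
rewrite /pushforward /=.
rewrite (_ : (_ @^-1` _) = `]c - a, d - a]%classic); last first.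
  by apply/seteqP; split => x /=; rewrite !in_itv /= ltrBlDr lerBrDr.
rewrite !lebesgue_measure_itv/= !lte_fin ltrD2r.
by case: ifP => // _; rewrite -!EFinB; congr EFin; ring.
Qed.

Lemma integral_shift (a : R) (g : TR -> \bar R) : (forall x, 0 <= g x)%E ->
  (\int[mu]_x g (x + a)%R = \int[mu]_x g x)%E.
Proof.
apply: (@integral_comp (fun x => x + a) (fun x => x - a)).
- exact: measurable_funD.
- exact: measurable_funB.
- by move=> x; rewrite subrK.
- by move=> x; rewrite addrK.
- by move=> A; exact: lebesgue_measure_shift.
Qed.

Lemma integral_opp (g : TR -> \bar R) : (forall x, 0 <= g x)%E ->
  (\int[mu]_x g (- x)%R = \int[mu]_x g x)%E.
Proof.
apply: (@integral_comp -%R -%R).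
- exact: measurable_funN.
- exact: measurable_funN.
- by move=> x; rewrite opprK.
- by move=> x; rewrite opprK.
- by move=> A; exact: lebesgue_measureN.
Qed.
End ShiftInvariance.

Section Volume.
Context (R : realType).

Lemma vol_ge0 n (A : set 'rV[R]_n) : (0 <= vol A)%E.
Proof.
by elim: n A => [|n IHn] A /=; [rewrite lee_fin | exact: integral_ge0].
Qed.

Lemma vol_shift n (v : 'rV[R]_n) (A : set 'rV[R]_n) :
  vol [set y | A (y + v)] = vol A.
Proof.
elim: n v A => [|n IHn] v A /=.
  by rewrite (_ : [set y | _] = A) //; apply/funext => y /=; rewrite (thinmx0 v) addr0.
pose g (a : measurableTypeR R) := vol [set y : 'rV[R]_n | A (row_mx (a%:M : 'rV[R]_1) y)].
rewrite -[RHS](@integral_shift R (v 0 0) g) => [|a]; last exact: vol_ge0.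
apply: eq_integral => a _.
rewrite /g -[RHS](IHn (rsubmx (v : 'rV_(1 + n)))); congr vol; apply/funext => y /=; congr A.
have Ev : v = row_mx ((v 0 0)%:M : 'rV[R]_1) (rsubmx (v : 'rV_(1 + n))).
  apply: etrans (esym (hsubmxK (v : 'rV_(1 + n)))) _; congr (row_mx _ _).
  apply/matrixP => i j; rewrite !ord1 !mxE mulr1n; congr (v _ _).
  exact/val_inj.
rewrite [in LHS]Ev; apply/rowP => j; rewrite !mxE.
by case: split_ordP => k _; rewrite !mxE // -mulrnDl.
Qed.

Lemma vol_opp n (A : set 'rV[R]_n) : vol [set y | A (- y)] = vol A.
Proof.
elim: n A => [|n IHn] A /=.
  by rewrite (_ : [set y | _] = A) //; apply/funext => y /=; rewrite (thinmx0 (- y)) (thinmx0 y).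
pose g (a : measurableTypeR R) := vol [set y : 'rV[R]_n | A (row_mx (a%:M : 'rV[R]_1) y)].
rewrite -[RHS](@integral_opp R g) => [|a]; last exact: vol_ge0.
apply: eq_integral => a _; rewrite /g -[RHS]IHn; congr vol; apply/funext => y /=; congr A.
apply/rowP => j; rewrite !mxE.
by case: split_ordP => k _; rewrite !mxE // mulNrn.
Qed.

Lemma vol_set0 n : vol (set0 : set 'rV[R]_n) = 0%E.
Proof.
elim: n => [|n IHn] /=; first by rewrite indic0.
by apply: integral0_eq => a _; rewrite -[RHS]IHn.
Qed.

Lemma vol_cube n (r : R) : 0 <= r ->
  vol [set y : 'rV[R]_n | forall i, `|y 0 i| <= r] = ((r *+ 2) ^+ n)%:E.
Proof.
move=> r0; elim: n => [|n IHn] /=.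
  by rewrite indicE mem_set //= => -[].
transitivity (\int[@lebesgue_measure R]_(a in `[(- r)%R, r]%classic) ((r *+ 2) ^+ n)%:E)%E; last first.
  rewrite integral_cst//= lebesgue_measure_itv/= lte_fin.
  case: ifPn => [_|]; first by rewrite -EFinB -EFinM opprK exprSr.
  rewrite -leNgt => rr; have -> : r = 0 by lra.
  by rewrite mule0 mul0rn expr0n.
rewrite [RHS]integral_mkcond; apply: eq_integral => a _; rewrite patchE.
case: ifPn => [/set_mem|/negP] /=.
  rewrite in_itv /= -ler_norml => ar; rewrite -IHn; congr vol; apply/funext => y /=.
  apply/propext; split => [H i|H i]; first by have := H (rshift 1 i); rewrite (@row_mxEr _ 1 1 n).
  rewrite mxE; case: split_ordP => j _ //.
  by rewrite ord1 mxE mulr1n.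
move=> H; rewrite (_ : [set y | _] = set0) ?vol_set0 //.
apply/seteqP; split => // y /= /(_ (@lshift 1 n ord0)); rewrite (@row_mxEl _ 1 1 n) mxE mulr1n => ar.
by apply: H; rewrite inE /= in_itv /= -ler_norml.
Qed.
End Volume.

(** * Borel sets of row vectors *)
Section BorelRowVectors.
Context (R : realType) (n : nat).

Definition rVborel : measurableType _ :=
  g_sigma_algebraType [set A : set 'rV[R]_n | open A].

Lemma borelE (A : set 'rV[R]_n) : borel A = measurable (A : set rVborel).
Proof. by []. Qed.

Lemma open_borel (A : set 'rV[R]_n) : open A -> borel A.
Proof. exact: sub_sigma_algebra. Qed.

Lemma closed_borel (A : set 'rV[R]_n) : closed A -> borel A.
Proof.
move=> cA; rewrite borelE -[A]setCK; apply: measurableC.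
by apply: open_borel; rewrite openC.
Qed.

Lemma continuous_borel (g : 'rV[R]_n -> R) : continuous (g : _ -> R^o) ->
  measurable_fun setT (g : rVborel -> R).
Proof.
move=> /continuousP cg; apply: (measurability _ (RGenOpens.measurableE R)).
move=> _ [_ [a [b ->]] <-]; rewrite setTI; apply: open_borel; apply: cg.
exact: interval_open.
Qed.

Lemma measurable_coord i : measurable_fun setT (fun v : rVborel => (v : 'rV[R]_n) 0 i).
Proof. by apply: continuous_borel => v; exact: coord_continuous. Qed.

Let box (ab : 'rV[rat]_n * 'rV[rat]_n) : set 'rV[R]_n :=
  [set v | forall i, ratr (ab.1 0 i) < v 0 i < ratr (ab.2 0 i)].

Lemma open_boxes (A : set 'rV[R]_n) : open A ->
  A = \bigcup_ab (if `[< box ab `<=` A >] then box ab else set0).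
Proof.
move=> oA; apply/seteqP; split => [v Av|v [ab _]]; last by case: ifPn => // /asboolP; exact.
have /nbhs_normP[e /= e0 eA] : nbhs v A by rewrite nbhsE; exists A.
have /choice[a aP] : forall i, exists a : rat, v 0 i - e / 2 < ratr a < v 0 i.
  move=> i; have : v 0 i - e / 2 < v 0 i by rewrite ltrBlDr ltrDl divr_gt0.
  by move=> /rat_in_itvoo[a]; rewrite in_itv; exists a.
have /choice[b bP] : forall i, exists b : rat, v 0 i < ratr b < v 0 i + e / 2.
  move=> i; have : v 0 i < v 0 i + e / 2 by rewrite ltrDl divr_gt0.
  by move=> /rat_in_itvoo[b]; rewrite in_itv; exists b.
exists (\row_i a i, \row_i b i) => //.
case: ifPn => [_|/asboolP[w boxw]].
  by move=> i /=; rewrite !mxE; have /andP[_ ->] := aP i; have /andP[-> _] := bP i.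
apply: eA => /=; apply: (@le_lt_trans _ _ (e / 2)); last by rewrite ltr_pdivrMr // mulr2n; lra.
apply: normr_le_coord => [|i]; first by rewrite ltW // divr_gt0.
have := boxw i; rewrite /= !mxE; have /andP[a1 a2] := aP i; have /andP[b1 b2] := bP i.
by move=> /andP[w1 w2]; rewrite ler_norml; lra.
Qed.

(** Open sets are countable unions of boxes with rational corners. *)
Lemma measurable_rV d (T : measurableType d) (X : T -> rVborel) :
  (forall i, measurable_fun setT (fun t => (X t : 'rV[R]_n) 0 i)) ->
  measurable_fun setT X.
Proof.
move=> mX; apply: (@measurability _ _ T rVborel setT X [set A : set 'rV[R]_n | open A] erefl).
move=> _ [A oA <-]; rewrite setTI (open_boxes oA) preimage_bigcup.
apply: countable_bigcupT_measurable => [|ab]; first exact: countableP.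
case: ifPn => _; last by rewrite preimage_set0.
have -> : X @^-1` box ab = \bigcap_(i in [set: 'I_n])
    ((fun t => (X t : 'rV[R]_n) 0 i) @^-1` `]ratr (ab.1 0 i), ratr (ab.2 0 i)[%classic).
  apply/seteqP; split => [t H i _|t H i] /=; first by rewrite in_itv; exact: H.
  by have := H i Logic.I; rewrite /= in_itv.
apply: fin_bigcap_measurable => // i _.
by rewrite -[X in measurable X]setTI; exact: mX.
Qed.
Lemma measurable_combination d (T : measurableType d) M (l : nat -> T -> R) (X : nat -> T -> rVborel) :
  (forall j, (j < M)%N -> measurable_fun setT (l j)) ->
  (forall j, (j < M)%N -> measurable_fun setT (X j)) ->
  measurable_fun setT (fun w => \sum_(j < M) l j w *: (X j w : 'rV[R]_n) : rVborel).
Proof.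
move=> ml mX; apply: measurable_rV => i.
have -> : (fun w => (\sum_(j < M) l j w *: (X j w : 'rV[R]_n)) 0 i) =
  (fun w => \sum_(j < M) l j w * (X j w : 'rV[R]_n) 0 i).
  by apply/funext => w; rewrite summxE; apply: eq_bigr => j _; rewrite mxE.
apply: measurable_sum => j; apply: measurable_funM; first exact: ml.
by apply: (measurableT_comp (measurable_coord i)); exact: mX.
Qed.

Lemma measurable_addv d (T : measurableType d) (X Y : T -> rVborel) :
  measurable_fun setT X -> measurable_fun setT Y ->
  measurable_fun setT (fun w => (X w : 'rV[R]_n) + Y w : rVborel).
Proof.
move=> mX mY; apply: measurable_rV => i.
have -> : (fun w => ((X w : 'rV[R]_n) + Y w) 0 i) =
  (fun w => (X w : 'rV[R]_n) 0 i) \+ (fun w => (Y w : 'rV[R]_n) 0 i).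
  by apply/funext => w; rewrite !mxE.
by apply: measurable_funD; apply: (measurableT_comp (measurable_coord i)).
Qed.

Lemma measurable_scalev d (T : measurableType d) (l : T -> R) (X : T -> rVborel) :
  measurable_fun setT l -> measurable_fun setT X ->
  measurable_fun setT (fun w => l w *: (X w : 'rV[R]_n) : rVborel).
Proof.
move=> ml mX; apply: measurable_rV => i.
have -> : (fun w => (l w *: (X w : 'rV[R]_n)) 0 i) =
  (fun w => l w * (X w : 'rV[R]_n) 0 i).
  by apply/funext => w; rewrite !mxE.
by apply: measurable_funM => //; apply: (measurableT_comp (measurable_coord i)).
Qed.
End BorelRowVectors.

(** * The uniform law on the unit ball *)
Section UniformBall.
Context (R : realType) (n : nat).
Implicit Types A : set 'rV[R]_n.

Definition cube (r : R) : set 'rV[R]_n := [set u | `|u| <= r].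

Lemma borel_cube (r : R) : borel (cube r).
Proof.
apply: closed_borel.
have -> : cube r = closed_ball_ (fun x : 'rV[R]_n => `|x|) 0 r.
  by apply/funext => u; rewrite /cube /closed_ball_ /= sub0r normrN.
exact: closed_closed_ball_.
Qed.

Lemma cube_ball (r : R) : r <= n.+1%:R^-1 -> cube r `<=` @unit_ball R n.
Proof.
move=> rn u ur; rewrite /unit_ball /= /enorm -[leRHS]sqrtr1 ler_wsqrtr //.
have n0 : 0 < (n.+1%:R : R) by rewrite ltr0n.
have un i : `|u 0 i| <= n.+1%:R^-1.
  by rewrite (le_trans (normr_coord_le u i)) // (le_trans ur).
apply: (@le_trans _ _ (\sum_(i < n) n.+1%:R^-1)).
  apply: ler_sum => i _; rewrite -expr2 -real_normK ?num_real // expr2.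
  rewrite (le_trans (ler_pM _ _ (un i) (un i))) //.
  by rewrite ler_piMl ?invr_ge0 ?ler0n // invf_le1 // ler1n.
by rewrite sumr_const card_ord -[leLHS]mulr_natl ler_pdivrMr // mul1r ler_nat.
Qed.

Lemma unif_shift A v : A `<=` @unit_ball R n -> [set y | A (y + v)] `<=` @unit_ball R n ->
  unif_ball [set y | A (y + v)] = unif_ball A.
Proof.
by move=> AB AvB; rewrite /unif_ball !setIidl // vol_shift.
Qed.

Lemma unif_opp A : unif_ball [set y | A (- y)] = unif_ball A.
Proof.
rewrite /unif_ball -(vol_opp (A `&` _)); congr (fine (vol _) / _).
apply/funext => y /=; apply/propext; rewrite /unit_ball /= /enorm dotvNl dotvNr opprK.
by [].
Qed.

Lemma unif_cube (r : R) : 0 <= r -> r <= n.+1%:R^-1 ->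
  unif_ball (cube r) = (r *+ 2) ^+ n / fine (vol (@unit_ball R n)).
Proof.
move=> r0 rn; rewrite /unif_ball setIidl; last exact: cube_ball.
rewrite (_ : cube r = [set y | forall i, `|y 0 i| <= r]) ?vol_cube //.
apply/seteqP; split => [y yr i|y yr]; first exact: le_trans (normr_coord_le _ _) yr.
exact: normr_le_coord.
Qed.
End UniformBall.

(** * A draw that is uniform given some information *)
Section Draw.
Context (R : realType) (n : nat) (d : measure_display) (Omega : measurableType d).
Context (P : probability Omega R) (S : set (set Omega)) (X : Omega -> 'rV[R]_n).
Hypothesis sS : sigma_algebra setT S.
Hypothesis subS : S `<=` (measurable : set (set Omega)).
Hypothesis mX : forall A, borel A -> measurable (X @^-1` A).
Hypothesis unifX : forall E A, S E -> borel A ->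
  P (E `&` X @^-1` A) = (P E * (unif_ball A)%:E)%E.

Implicit Types A B : set 'rV[R]_n.

Let S_setT : S setT.
Proof. by case: sS => S0 SC _; rewrite -(setD0 setT); apply: SC. Qed.

(** Through this identity the properties of the measure [P] pass to [unif_ball]. *)
Lemma draw_law A : borel A -> P (X @^-1` A) = (unif_ball A)%:E.
Proof.
by move=> bA; rewrite -[X in P X]setTI unifX // [P _]probability_setT mul1e.
Qed.

Lemma unif_ge0 A : borel A -> 0 <= unif_ball A.
Proof. by move=> bA; rewrite -lee_fin -draw_law. Qed.

(** Otherwise the division in [unif_ball] would give probability 0 to the whole
    space. *)
Lemma unif_ball_pos : 0 < fine (vol (@unit_ball R n)).
Proof.
rewrite lt_neqAle fine_ge0 ?vol_ge0 // andbT; apply/eqP => v0.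
have bT : borel (setT : set 'rV[R]_n) by rewrite borelE; exact: measurableT.
have := draw_law bT; rewrite preimage_setT [P _]probability_setT => -[].
by rewrite /unif_ball -v0 invr0 mulr0 => /eqP; rewrite oner_eq0.
Qed.

Lemma unif_cube_gt0 r : 0 < r -> r <= n.+1%:R^-1 -> 0 < unif_ball (@cube R n r).
Proof.
move=> r0 rn; rewrite unif_cube ?(ltW r0) // divr_gt0 ?unif_ball_pos //.
by rewrite exprn_gt0 // pmulrn_lgt0.
Qed.

Lemma le_unif A B : borel A -> borel B -> A `<=` B -> unif_ball A <= unif_ball B.
Proof.
move=> bA bB AB; rewrite -lee_fin -!draw_law //.
by apply: le_measure; rewrite ?inE; [exact: mX|exact: mX|move=> w; exact: AB].
Qed.

Lemma le_unifU A B : borel A -> borel B -> unif_ball (A `|` B) <= unif_ball A + unif_ball B.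
Proof.
move=> bA bB; rewrite -lee_fin EFinD -!draw_law //; last by rewrite borelE; exact: measurableU.
by rewrite preimage_setU; apply: measureU2; exact: mX.
Qed.

Lemma unif_null_bigcup (A : nat -> set 'rV[R]_n) : (forall i, borel (A i)) ->
  (forall i, unif_ball (A i) = 0) -> unif_ball (\bigcup_i A i) = 0.
Proof.
move=> bA A0; have bU : borel (\bigcup_i A i) by rewrite borelE; apply: bigcup_measurable => k _; exact: bA.
have /eqP : P (X @^-1` (\bigcup_i A i)) = 0%E.
  rewrite -(negligibleP P (mX bU)) preimage_bigcup; apply: negligible_bigcup => i.
  by apply/(negligibleP P (mX (bA i))); rewrite [LHS]draw_law // A0.
by rewrite draw_law // eqe => /eqP.
Qed.

(** Integrate the pointwise bound on the number of sets [A m] that contain [X]. *)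
Lemma sum_unif_le M (A : nat -> set 'rV[R]_n) (K : R) :
  (forall m, borel (A m)) -> (forall u, \sum_(m < M) \1_(A m) u <= K) ->
  \sum_(m < M) unif_ball (A m) <= K.
Proof.
move=> bA AK; rewrite -lee_fin -sumEFin.
have mXA m : measurable (X @^-1` A m) by exact: mX.
have -> : (\sum_(m < M) (unif_ball (A m))%:E = \sum_(m < M) \int[P]_w (\1_(X @^-1` A m) w)%:E)%E.
  by apply: eq_bigr => m _; rewrite integral_indic // setIT; apply/esym/draw_law.
rewrite -ge0_integral_sum //; last first.
  by move=> m; apply/measurable_EFinP; exact: measurable_indic.
have -> : (K%:E = \int[P]_w K%:E)%E by rewrite integral_cst // [X in (_ * X)%E]probability_setT mule1.
have K0 : 0 <= K.
  by apply: le_trans (AK 0); apply: sumr_ge0 => m _.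
apply: ge0_le_integral => //.
- by move=> w _; apply: sume_ge0 => m _; rewrite lee_fin.
- by apply: emeasurable_fun_sum => m; apply/measurable_EFinP; exact: measurable_indic.
- by move=> w _; rewrite sumEFin lee_fin; exact: AK.
Qed.
End Draw.

(** * Good draws *)
Section GoodDraw.
Context (R : realType) (n : nat) (d : measure_display) (Omega : measurableType d).
Context (P : probability Omega R) (S : set (set Omega)) (X : Omega -> 'rV[R]_n).
Hypothesis sS : sigma_algebra setT S.
Hypothesis subS : S `<=` (measurable : set (set Omega)).
Hypothesis mX : forall A, borel A -> measurable (X @^-1` A).
Hypothesis unifX : forall E A, S E -> borel A ->
  P (E `&` X @^-1` A) = (P E * (unif_ball A)%:E)%E.
Local Notation rVb := (rVborel R n).

(** On the information [S] the product formula says that the outcome and the draw have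
    a product law, so the probability on the right is the integral over [E] of the
    uniform probabilities of the sections of [G] at [Y w]. *)
Lemma draw_freezing E (Y : Omega -> 'rV[R]_n) (G : set (rVb * rVb)) (p : R) :
  S E -> (forall A, borel A -> S (Y @^-1` A)) -> measurable G -> 0 <= p ->
  (forall y, p <= unif_ball [set u | G (y, u)]) ->
  (p%:E * P E <= P (E `&` [set w | G (Y w, X w)]))%E.
Proof.
move=> SE mY mG p0 Gp.
pose OS : measurableType _ := g_sigma_algebraType S.
have mOS (A : set OS) : measurable A = S A.
  by rewrite /measurable /= sigma_algebra_id.
have mid : measurable_fun setT (id : Omega -> OS).
  by move=> _ A; rewrite mOS setTI => SA; exact: subS.
have mX' : measurable_fun setT (X : Omega -> rVb).
  by move=> _ A mA; rewrite setTI; exact: mX.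
pose idS : {mfun Omega >-> OS} := HB.pack (id : Omega -> OS)
  (isMeasurableFun.Build _ _ _ _ _ mid).
pose XS : {mfun Omega >-> rVb} := HB.pack (X : Omega -> rVb)
  (isMeasurableFun.Build _ _ _ _ _ mX').
have mj : measurable_fun setT (fun w => (idS w, XS w)).
  exact: measurable_fun_pair.
pose J : {mfun Omega >-> (OS * rVb)%type} := HB.pack (fun w => (idS w, XS w))
  (isMeasurableFun.Build _ _ _ _ _ mj).
pose Z : set (OS * rVb) := [set z | E z.1 /\ G (Y z.1, z.2)].
have mZ : measurable Z.
  rewrite (_ : Z = (fst @^-1` E) `&` ((fun z : OS * rVb => (Y z.1 : rVb, z.2)) @^-1` G)) //.
  have mE : measurable (E : set OS) by rewrite mOS.
  have mY' : measurable_fun setT (Y : OS -> rVb).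
    by move=> _ A mA; rewrite setTI mOS; exact: mY.
  apply: measurableI.
    by rewrite -[X in measurable X]setTI; exact: measurable_fst.
  rewrite -[X in measurable X]setTI.
  apply: (@measurable_fun_pair _ _ _ (OS * rVb)%type rVb rVb (fun z => Y z.1) snd) => //.
  by apply: measurableT_comp => //; exact: measurable_fst.
(* [J] is the joint law of the outcome, known up to [S], and the draw. *)
have := @product_measure_unique _ _ OS rVb R (distribution P idS) (distribution P XS)
  (distribution P J).
move=> /(_ _ _ mZ) => uniq.
have -> : P (E `&` [set w | G (Y w, X w)]) = distribution P J Z by [].
rewrite -uniq; last first.
  move=> A B; rewrite mOS => SA mB.
  by rewrite -[RHS]/(P A * P (X @^-1` B))%E (draw_law sS unifX) // -unifX.
rewrite /product_measure1.
have mEO : measurable (E : set OS) by rewrite mOS.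
have -> : (p%:E * P E = \int[distribution P idS]_w (p%:E * (\1_(E : set OS) w)%:E))%E.
  rewrite ge0_integralZl_EFin //; last by apply/measurable_EFinP; exact: measurable_indic.
  by rewrite integral_indic // setIT.
apply: ge0_le_integral => //.
- by move=> w _; rewrite -EFinM lee_fin mulr_ge0.
- by apply: measurable_funeM; apply/measurable_EFinP; exact: measurable_indic.
- exact: measurable_fun_xsection.
move=> w _ /=; rewrite indicE; case: (boolP (w \in _)) => [/set_mem Ew|_]; last first.
  by rewrite mule0; exact: measure_ge0.
have -> : xsection Z w = [set u | G (Y w, u)].
  by apply/seteqP; split => u; rewrite /xsection /Z /= inE /=; [case|].
rewrite mule1 -[X in (_ <= X)%E]/(P (X @^-1` [set u | G (Y w, u)])).
rewrite (draw_law sS unifX) ?lee_fin //.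
have -> : [set u | G (Y w, u)] = xsection G (Y w).
  by apply/seteqP; split => u; rewrite /xsection /= inE.
rewrite borelE; exact: measurable_xsection.
Qed.

Context (f : 'rV[R]_n -> R) (sigma r : R).
Hypothesis hf : convex_function (setT : set 'rV[R]_n) f.
Hypothesis sigma0 : 0 < sigma.
Hypothesis r0 : 0 < r.
Hypothesis rn : r *+ 2 <= n.+1%:R^-1.
Local Notation e j := (delta_mx 0 j : 'rV[R]_n).

Definition kink_draw (y : 'rV[R]_n) j q : set 'rV[R]_n :=
  [set u | `|u| <= r /\ kink f j q (y + sigma *: u)].

Definition ascent_draw (y : 'rV[R]_n) : set 'rV[R]_n :=
  [set u | `|u| <= r /\ f y <= f (y + sigma *: u)].

(** If [f y] exceeds a threshold, then so does the value of [f] at [y + sigma u] for a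
    good draw [u], and [f] is differentiable at this point: a perturbation routine
    that looks for such points accepts the trial. *)
Definition good_draw (y : 'rV[R]_n) : set 'rV[R]_n :=
  [set u | ascent_draw y u /\ forall j q, ~ kink f j q (y + sigma *: u)].

Lemma measurable_affine : measurable_fun setT
  (fun z : rVb * rVb => (z.1 : 'rV[R]_n) + sigma *: (z.2 : 'rV[R]_n) : rVb).
Proof.
apply: measurable_rV => i.
have -> : (fun t : rVb * rVb => ((t.1 : 'rV[R]_n) + sigma *: (t.2 : 'rV[R]_n)) 0 i) =
  (fun t => (t.1 : 'rV[R]_n) 0 i) \+ (fun t => sigma * (t.2 : 'rV[R]_n) 0 i).
  by apply/funext => t; rewrite !mxE.
apply: measurable_funD.
  by apply: (measurableT_comp (measurable_coord i)); exact: measurable_fst.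
apply: measurable_funM => //.
by apply: (measurableT_comp (measurable_coord i)); exact: measurable_snd.
Qed.

Lemma measurable_ascent : measurable [set z : rVb * rVb | ascent_draw z.1 z.2].
Proof.
have fm : measurable_fun setT (f : rVb -> R).
  by apply: continuous_borel; exact: convex_continuous.
have -> : [set z : rVb * rVb | ascent_draw z.1 z.2] =
  (snd @^-1` (cube r : set rVb)) `&` ((fun z : rVb * rVb =>
   f ((z.1 : 'rV[R]_n) + sigma *: (z.2 : 'rV[R]_n)) - f z.1) @^-1` `[0, +oo[%classic).
  by apply/seteqP; split => z /=; rewrite in_itv /= andbT subr_ge0.
apply: measurableI; rewrite -[X in measurable X]setTI.
  by apply: measurable_snd => //; exact: borel_cube.
have mg : measurable_fun setT (fun z : rVb * rVb =>
   f ((z.1 : 'rV[R]_n) + sigma *: (z.2 : 'rV[R]_n)) - f z.1).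
  apply: measurable_funB; first exact: (measurableT_comp fm measurable_affine).
  by apply: (measurableT_comp fm); exact: measurable_fst.
exact: mg.
Qed.

Lemma measurable_kink_draw j q : measurable [set z : rVb * rVb | kink_draw z.1 j q z.2].
Proof.
have -> : [set z : rVb * rVb | kink_draw z.1 j q z.2] =
  (snd @^-1` (cube r : set rVb)) `&` ((fun z : rVb * rVb =>
   (z.1 : 'rV[R]_n) + sigma *: (z.2 : 'rV[R]_n) : rVb) @^-1` kink f j q) by [].
apply: measurableI; rewrite -[X in measurable X]setTI.
  by apply: measurable_snd => //; exact: borel_cube.
apply: measurable_affine => //; apply: closed_borel; exact: closed_kink.
Qed.

Lemma measurable_good : measurable [set z : rVb * rVb | good_draw z.1 z.2].
Proof.
have -> : [set z : rVb * rVb | good_draw z.1 z.2] =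
  [set z | ascent_draw z.1 z.2] `&` ~` \bigcup_q \bigcup_(j in [set: 'I_n])
      [set z : rVb * rVb | kink_draw z.1 j q z.2].
  apply/seteqP; split => [z [az nk]|z [az nk]]; split => //.
    by move=> [q _ [j _ [_ zk]]]; exact: (nk j q).
  by move=> j q zk; apply: nk; exists q => //; exists j => //; split => //; case: az.
apply: measurableI; first exact: measurable_ascent.
apply: measurableC; apply: bigcup_measurable => q _.
apply: fin_bigcup_measurable => // j _; exact: measurable_kink_draw.
Qed.

Lemma borel_section (G : set (rVb * rVb)) y : measurable G -> borel [set u | G (y, u)].
Proof.
move=> mG; have -> : [set u | G (y, u)] = xsection G y.
  by apply/seteqP; split => u; rewrite /xsection /= inE.
rewrite borelE; exact: measurable_xsection.
Qed.

Lemma borel_kink_draw y j q : borel (kink_draw y j q).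
Proof. exact: (borel_section y (measurable_kink_draw j q)). Qed.

Lemma borel_ascent_draw y : borel (ascent_draw y).
Proof. exact: (borel_section y measurable_ascent). Qed.

Lemma borel_good_draw y : borel (good_draw y).
Proof. exact: (borel_section y measurable_good). Qed.

(** The translates of the set by the multiples of [r / (M + 1)] along [e j] stay in
    the unit ball and have the same probability. By [kink_count] a point belongs to
    at most [K] of these [M + 1] translates, where [K] does not depend on [M]. *)
Lemma unif_kink_draw y j q : unif_ball (kink_draw y j q) = 0.
Proof.
set T := kink_draw y j q.
have bT : borel T := borel_kink_draw y j q.
(* The translates reach [r *+ 2] and the second differences one step [h <= r] further. *)
have rho0 : 0 < `|y| + sigma * (r *+ 3) by rewrite ltr_wpDl // mulr_gt0 // pmulrn_lgt0.
have [L [L0 fL]] := convex_lipschitz hf rho0.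
pose K := L * q.+1%:R *+ 2.
have K0 : 0 <= K by rewrite mulrn_wge0 // mulr_ge0 // ltW.
have key M : M.+1%:R * unif_ball T <= K.
  have M0 : 0 < (M.+1%:R : R) by rewrite ltr0n.
  pose h := r / M.+1%:R.
  have h0 : 0 < h by rewrite divr_gt0.
  have hM : M.+1%:R * h = r by rewrite mulrC divfK ?gt_eqF.
  have hr : h <= r by rewrite ler_pdivrMr // ler_peMr ?ler1n // ltW.
  pose A m := [set u | T (u + (- (m%:R * h)) *: e j)].
  have norm_e t : `|t *: e j| <= `|t|.
    by rewrite normrZ -[leRHS]mulr1 ler_wpM2l // normr_delta_le.
  have mh m : (m < M.+1)%N -> 0 <= m%:R * h <= r.
    move=> mM; rewrite mulr_ge0 ?(ltW h0) //= -hM ler_pM2r // ler_nat ltnW //.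
  have A2 m u : (m < M.+1)%N -> A m u -> `|u| <= r *+ 2.
    move=> mM [ur _]; have -> : u = u + - (m%:R * h) *: e j + (m%:R * h) *: e j.
      by rewrite -addrA -scalerDl addNr scale0r addr0.
    have /andP[mh0 mhr] := mh m mM.
    rewrite (le_trans (ler_normD _ _)) // mulr2n lerD // (le_trans (norm_e _)) //.
    by rewrite ger0_norm.
  have rn' : r <= n.+1%:R^-1 by apply: le_trans rn; rewrite mulr2n lerDl ltW.
  have uA m : (m < M.+1)%N -> unif_ball (A m) = unif_ball T.
    move=> mM; apply: unif_shift.
      by move=> u [ur _]; exact: (cube_ball rn').
    by move=> u Au; apply: (cube_ball rn); exact: (A2 m).
  have bA m : borel (A m).
    have mA : measurable_fun setT (fun u : rVb => (u : 'rV[R]_n) + - (m%:R * h) *: e j : rVb).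
      apply: measurable_rV => i.
      have -> : (fun t : rVb => ((t : 'rV[R]_n) + - (m%:R * h) *: e j) 0 i) =
        (fun t => (t : 'rV[R]_n) 0 i) \+ cst ((- (m%:R * h) *: e j) 0 i).
        by apply/funext => t; rewrite !mxE.
      by apply: measurable_funD => //; exact: measurable_coord.
    by rewrite borelE -[X in measurable X]setTI; exact: mA.
  have -> : M.+1%:R * unif_ball T = \sum_(m < M.+1) unif_ball (A m).
    rewrite (eq_bigr (fun=> unif_ball T)); last by move=> m _; exact: uA.
    by rewrite sumr_const card_ord mulr_natl.
  apply: (sum_unif_le sS mX unifX) => // u.
  have [ur|ur] := leP `|u| (r *+ 2); last first.
    rewrite big1 // => m _; rewrite indicE memNset // => Au.
    by have := A2 m u (ltn_ord m) Au; rewrite leNgt ur.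
  have sh0 : 0 < sigma * h by rewrite mulr_gt0.
  have fL' a b : `|a| <= `|y| + sigma * (r *+ 3) -> `|b| <= `|y| + sigma * (r *+ 3) ->
    `|f a - f b| <= L * `|a - b| by exact: fL.
  have range t : - (sigma * h) <= t <= M.+1%:R * (sigma * h) ->
      `|(y + sigma *: u) - t *: e j| <= `|y| + sigma * (r *+ 3).
    move=> /andP[t1 t2]; have tr : `|t| <= sigma * r.
      rewrite ler_norml (le_trans t2) ?andbT; last by rewrite mulrCA hM.
      by rewrite (le_trans _ t1) // lerN2 ler_pM2l.
    rewrite -addrA (le_trans (ler_normD _ _)) // lerD2l (le_trans (ler_normB _ _)) //.
    rewrite normrZ gtr0_norm // mulrSr mulrDr lerD //; first by rewrite ler_pM2l.
    exact: le_trans (norm_e _) tr.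
  apply: le_trans (@kink_count _ _ _ hf j q _ _ _ _ _ sh0 (ltW L0) fL' range).
  apply: ler_sum => m _; rewrite !indicE.
  case: (boolP (u \in A m)) => [/set_mem [_ uk]|//].
  rewrite mem_set //; move: uk; congr kink.
  by apply/rowP => i; rewrite !mxE; ring.
apply/eqP; rewrite eq_le (unif_ge0 sS unifX) // andbT leNgt; apply/negP => T0.
have [M] := ltr_add_invr (divr_gt0 T0 (ltr_wpDl K0 ltr01)); rewrite add0r.
have M0 : 0 < (M.+1%:R : R) by rewrite ltr0n.
have K1 : 0 < K + 1 by rewrite ltr_wpDl.
rewrite ltr_pdivlMr // mulrC ltr_pdivrMr // mulrC => H.
by have := le_lt_trans (key M) (ltr_pwDr ltr01 (lexx K)); rewrite ltNge (ltW H).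
Qed.

(** By convexity [u] or [- u] is an ascent draw, so the ascent draws and their
    reflections cover the cube; among ascent draws only the null set of kinks is not
    good. *)
Lemma unif_good_draw y : unif_ball (cube r : set 'rV[R]_n) / 2 <= unif_ball (good_draw y).
Proof.
pose kd (o : option ('I_n * nat)) :=
  if o is Some (j, q) then kink_draw y j q else set0.
pose N := \bigcup_i kd (choice.unpickle i).
have bNi i : borel (kd (choice.unpickle i)).
  by case: choice.unpickle => [[j q]|]; [exact: borel_kink_draw|rewrite borelE; exact: measurable0].
have bN : borel N by rewrite borelE; apply: bigcup_measurable => i _; exact: bNi.
have N0 : unif_ball N = 0.
  apply: (unif_null_bigcup sS mX unifX) => // i.
  case: choice.unpickle => [[j q]|]; first exact: unif_kink_draw.
  by rewrite /unif_ball set0I vol_set0 mul0r.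
have AN : unif_ball (ascent_draw y) <= unif_ball (good_draw y).
  rewrite -[leRHS]addr0 -N0.
  apply: le_trans (le_unifU sS mX unifX (borel_good_draw y) bN).
  apply: (le_unif sS mX unifX); [exact: borel_ascent_draw| |].
    rewrite borelE; apply: measurableU => //; exact: borel_good_draw.
  move=> u au; have [|nk] := pselect (exists j q, kink f j q (y + sigma *: u)).
    move=> [j [q k]]; right; exists (choice.pickle (j, q)) => //; rewrite choice.pickleK.
    by split => //; case: au.
  by left; split => // j q k; apply: nk; exists j, q.
apply: le_trans AN; rewrite ler_pdivrMr // mulr_natr mulr2n.
pose A' := [set u | ascent_draw y (- u)].
have bA' : borel A'.
  have mA : measurable_fun setT (fun u : rVb => - (u : 'rV[R]_n) : rVb).
    apply: measurable_rV => i.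
    have -> : (fun t : rVb => (- (t : 'rV[R]_n)) 0 i) = \- (fun t => (t : 'rV[R]_n) 0 i).
      by apply/funext => t; rewrite !mxE.
    by apply: measurable_funN; exact: measurable_coord.
  rewrite borelE -[X in measurable X]setTI; apply: mA => //; exact: borel_ascent_draw.
rewrite -[X in _ <= _ + X](unif_opp (ascent_draw y)).
apply: le_trans (le_unifU sS mX unifX (borel_ascent_draw y) bA').
apply: (le_unif sS mX unifX); first exact: borel_cube.
  rewrite borelE; apply: measurableU => //; exact: borel_ascent_draw.
move=> u ur; have := convex_mid hf y (sigma *: u).
have [H _|H] := leP (f y) (f (y + sigma *: u)); first by left.
right; split; first by rewrite normrN.
by rewrite scalerN; lra.
Qed.

End GoodDraw.

(** * Events that recur almost surely *)
Section Recurrence.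
Context (R : realType) (d : measure_display) (Omega : measurableType d).
Context (P : probability Omega R) (S : nat -> set (set Omega)).
Context (H : nat -> set Omega) (p : R).
Hypothesis sS : forall i, sigma_algebra setT (S i).
Hypothesis subS : forall i, S i `<=` (measurable : set (set Omega)).
Hypothesis mono : forall i, S i `<=` S i.+1.
Hypothesis HS : forall i, S i.+1 (H i).
Hypothesis p0 : 0 < p.
Hypothesis Hp : forall i E, S i E -> (p%:E * P E <= P (E `&` H i))%E.

Let miss N M : set Omega := \bigcap_(i in [set i | (N <= i < N + M)%N]) ~` H i.

Let missS N M : miss N M.+1 = miss N M `&` ~` H (N + M).
Proof.
apply/seteqP; split => [w mw|w [mw mwM] i /=].
  split => [i /= /andP[Ni iM]|]; last by apply: mw; rewrite /= leq_addr addnS ltnSn.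
  by apply: mw; rewrite /= Ni addnS (ltn_trans iM).
move=> /andP[Ni]; rewrite addnS ltnS leq_eqVlt => /orP[/eqP->//|iM].
by apply: mw; rewrite /= Ni.
Qed.

Let miss_past N M : S (N + M) (miss N M).
Proof.
have cS i A : S i A -> S i (~` A) by move=> SA; case: (sS i) => _ SC _; rewrite -setTD; exact: SC.
elim: M => [|M IHM].
  have -> : miss N 0 = ~` set0.
    apply/seteqP; split => [w _ []|w _ i /= /andP[Ni iN]].
    by move: (leq_ltn_trans Ni iN); rewrite [X in (_ < X)%N]addn0 ltnn.
  by apply: cS; case: (sS (N + 0)).
rewrite missS addnS -[X in S _ X]setCK setCI setCK; apply: (cS).
have mS : sigma_algebra setT (S (N + M).+1) by [].
have := @measurableU _ (g_sigma_algebraType (S (N + M).+1)) (~` miss N M) (H (N + M)).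
rewrite /measurable /= sigma_algebra_id //; apply => //.
by apply: cS; exact: mono.
Qed.

Lemma miss_le N M : (P (miss N M) <= ((1 - p) ^+ M)%:E)%E.
Proof.
have mm M' : measurable (miss N M') by apply: subS; exact: miss_past.
have p1 : p <= 1.
  have ST : S 0%N setT by case: (sS 0%N) => S0 SC _; rewrite -(setD0 setT); exact: SC.
  have := Hp ST; rewrite probability_setT mule1 => pH.
  rewrite -lee_fin; apply: le_trans pH _; apply: probability_le1.
  by apply: measurableI; apply: subS; [exact: ST|exact: HS].
elim: M => [|M IHM]; first by rewrite expr0; exact: probability_le1.
have mH : measurable (H (N + M)) by apply: subS; exact: HS.
have := Hp (miss_past N M).
have E : P (miss N M) = (P (miss N M `&` H (N + M)) + P (miss N M.+1))%E.
  by rewrite missS -setDE; rewrite addeC -measureDI.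
have fin A : measurable A -> P A \is a fin_num by move=> mA; exact: fin_num_measure.
rewrite E; move: IHM; rewrite E.
rewrite -(fineK (fin _ (measurableI _ _ (mm M) mH))) -(fineK (fin _ (mm M.+1))).
rewrite -!EFinD -EFinM !lee_fin exprS.
move: (fine _) (fine _) => a b ab pab.
have q0 : 0 <= 1 - p by rewrite subr_ge0.
by have := ler_wpM2l q0 ab; set X := _ * _ ^+ M; lra.
Qed.

(** Given the past, each event fails with probability at most [1 - p], so that [M]
    failures in a row have probability at most [(1 - p) ^ M]. *)
Lemma recurrence : {ae P, forall w, forall N, exists2 i, (N <= i)%N & H i w}.
Proof.
have mm N M : measurable (miss N M) by apply: subS; exact: miss_past.
apply/ae_foralln => N.
exists (\bigcap_M miss N M); split.
- by apply: bigcapT_measurable.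
- apply/eqP; rewrite eq_le measure_ge0 andbT; set a := P (\bigcap_M miss N M).
  have aM M : (a <= ((1 - p) ^+ M)%:E)%E.
    apply: le_trans (miss_le N M); apply: le_measure; rewrite ?inE //.
      exact: bigcapT_measurable.
    by move=> w; apply.
  have afin : a \is a fin_num by apply: fin_num_measure; exact: bigcapT_measurable.
  rewrite -[X in (X <= _)%E](fineK afin) lee_fin.
  have q1 : `|1 - p| < 1.
    have := aM 1%N; have : (0 <= a)%E by exact: measure_ge0.
    move=> a0 /(le_trans a0); rewrite lee_fin expr1 => q0.
    by rewrite ger0_norm // ltrBlDr ltrDl.
  apply: (cvgr_to_ge (cvg_expr q1)); apply: nearW => M.
  by rewrite -lee_fin fineK.
- move=> w /= nH M _ i /= /andP[Ni _] Hi; apply: nH; by exists i.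
Qed.
End Recurrence.

(** * A Borel version of the gradient *)
Section MeasurableGradient.
Context (R : realType) (n : nat) (f : 'rV[R]_n -> R).
Hypothesis hf : convex_function (setT : set 'rV[R]_n) f.
Local Notation e j := (delta_mx 0 j : 'rV[R]_n).

(** The upper limit of difference quotients makes this a Borel function on the whole
    space. *)
Definition borel_grad (x : 'rV[R]_n) : 'rV[R]_n :=
  \row_j fine (limn_esup (fun N => (N.+1%:R * (f (x + N.+1%:R^-1 *: e j) - f x))%:E)).

Lemma borel_gradE x : diffset f x -> borel_grad x = grad f x.
Proof.
move=> dx; apply/rowP => j; rewrite mxE.
have := @grad_cvg _ _ f x (e j) dx; rewrite dotv_delta => H.
have : (fun N => (N.+1%:R * (f (x + N.+1%:R^-1 *: e j) - f x))%:E) @ \oo --> (grad f x 0 j)%:E.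
  by apply: cvg_EFin; [exact: nearW|exact: H].
move=> H'; rewrite is_cvg_limn_esupE; first by rewrite (cvg_lim _ H').
by apply/cvg_ex; eexists; exact: H'.
Qed.

Lemma measurable_borel_grad : measurable_fun setT (borel_grad : rVborel R n -> rVborel R n).
Proof.
apply: measurable_rV => j.
have -> : (fun t : rVborel R n => borel_grad t 0 j) = (fun t : rVborel R n =>
    fine (limn_esup (fun N => (N.+1%:R * (f ((t : 'rV[R]_n) + N.+1%:R^-1 *: e j) - f t))%:E))).
  by apply/funext => t; rewrite mxE.
apply: measurableT_comp => //.
apply: measurable_fun_limn_esup => N; apply/measurable_EFinP.
apply: continuous_borel => x.
have := @convex_shift_continuous _ _ _ hf (N.+1%:R^-1 *: e j) x.
move=> c1; have c2 := @convex_continuous _ _ _ hf x.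
apply: (@cvgM _ _ (nbhs x)); first exact: cvg_cst.
exact: (@cvgB _ R^o _ (nbhs x)).
Qed.
End MeasurableGradient.

(** * The inner loop of one run *)
Lemma sum_fset_ord (V : zmodType) (J : {fset nat}) M (F : nat -> V) :
  (forall j, j \in J -> (j < M)%N) ->
  \sum_(j <- J) F j = \sum_(j < M) (if (j : nat) \in J then F j else 0).
Proof.
move=> JM; rewrite -big_mkcond /= -(big_mkord (fun j => j \in J) F) -[RHS]big_filter.
apply: perm_big; apply: uniq_perm; rewrite ?filter_uniq ?iota_uniq ?fset_uniq //.
move=> j; rewrite mem_filter mem_index_iota /=.
by case: (boolP (j \in J)) => // /JM ->.
Qed.

Lemma sum_fset_single (V : zmodType) (J : {fset nat}) a (F : nat -> V) : a \in J ->
  (forall j, j != a -> F j = 0) -> \sum_(j <- J) F j = F a.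
Proof.
move=> aJ F0; rewrite (bigD1_seq a) ?fset_uniq //= big1 ?addr0 // => j; exact: F0.
Qed.

Section Run.
Context (R : realType) (n : nat) (f : 'rV[R]_n -> R) (p : bgs_params R n).
Context (u : nat -> nat -> nat -> 'rV[R]_n) (tr : bgs_trace R n) (k : nat).
Hypothesis hf : convex_function (setT : set 'rV[R]_n) f.
Hypothesis hp : admissible f p.
Local Notation m := (p_m p).
Local Notation x := (tr_x tr k).
Local Notation eps := (tr_eps tr k).
Local Notation s := (tr_s tr k).
Local Notation J := (tr_J tr k).
Local Notation G := (aggr_g f p tr k).
Local Notation E := (aggr_e f p tr k).
Local Notation g j := (grad f (s j)).
Local Notation err := (lin_err f tr k).
Local Notation entered := (inner_entered f p u tr k).
Local Notation tau := (eps `^ p_alpha p).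

Lemma index_set_le i j : entered i -> j \in J i -> (j <= (m + i).+1)%N.
Proof.
elim: i j => [|i IHi] j /=.
  move=> [_ _ _ [K [[[KI _] _ _] ->]]]; rewrite !inE => /orP[/orP[/eqP->|/eqP->]|/KI] //.
  rewrite !inE mem_iota /= ?add0n ltnS addn0.
  by move=> /orP[/eqP->//|/andP[_ /leqW]].
move=> [ei _ _ _ [_ [K [[[KI _] _ _] ->]]]]; rewrite !inE.
move=> /orP[/orP[/eqP->|/eqP->]|/KI /(IHi _ ei)] //.
by rewrite addnS => /leqW.
Qed.

Lemma index_set_new i : entered i -> (m + i).+1 \in J i.
Proof.
by case: i => [[_ _ _ [K [_ ->]]]|i [_ _ _ _ [_ [K [_ ->]]]]]; rewrite !inE eqxx orbT.
Qed.

Lemma aux_diffset i j : entered i -> (j <= m + i)%N -> diffset f (s j).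
Proof.
elim: i j => [|i IHi] j; first by rewrite addn0 => -[_ + _ _]; apply.
move=> [ei _ [t [[dt _] _ sE]] _ _]; rewrite addnS leq_eqVlt => /orP[/eqP->|]; last exact: IHi.
by rewrite sE.
Qed.

Lemma index_diffset i j : entered i.+1 -> j \in J i -> diffset f (s j).
Proof.
move=> ei1 jJ; apply: (aux_diffset ei1); rewrite addnS.
by apply: index_set_le => //; case: ei1.
Qed.

Lemma aux_minorant j y : diffset f (s j) ->
  0 <= f y - f x - dotv (g j) (y - x) + err j.
Proof.
move=> dj; have := grad_ineq hf y dj; rewrite /lin_err.
have -> : y - s j = (y - x) + (x - s j) by rewrite addrA subrK.
by rewrite dotvDr; lra.
Qed.

(** The gradient inequality gives this minorant for each auxiliary point, and an
    aggregate is a convex combination of these. *)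
Lemma aggr_minorant i y : entered i -> 0 <= f y - f x - dotv (G i) (y - x) + E i.
Proof.
elim: i => [|i IHi] /=.
  move=> [_ D [[l0 l1] _] _].
  have -> : f y - f x - dotv (\sum_(j < m.+1) tr_lam tr k 0%N j *: g j) (y - x) +
      \sum_(j < m.+1) tr_lam tr k 0%N j * err j =
    \sum_(j < m.+1) tr_lam tr k 0%N j * (f y - f x - dotv (g j) (y - x) + err j).
    rewrite dotv_suml -[f y - f x in LHS]mul1r -l1 mulr_suml -sumrB -big_split /=.
    by apply: eq_bigr => j _; rewrite dotvZl; ring.
  apply: sumr_ge0 => j _; apply: mulr_ge0; first by apply: l0; rewrite -ltnS.
  by apply: aux_minorant; apply: D; rewrite -ltnS.
move=> ei1; have D j (jJ : j \in J i) := index_diffset ei1 jJ.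
move: ei1 => [ei _ _ _ [[[l0 t0 l1] _] _]].
have -> : f y - f x - dotv (\sum_(j <- J i) tr_lam tr k i.+1 j *: g j + tr_tlam tr k i.+1 *: G i)
     (y - x) + (\sum_(j <- J i) tr_lam tr k i.+1 j * err j + tr_tlam tr k i.+1 * E i) =
  \sum_(j <- J i) tr_lam tr k i.+1 j * (f y - f x - dotv (g j) (y - x) + err j) +
    tr_tlam tr k i.+1 * (f y - f x - dotv (G i) (y - x) + E i).
  rewrite dotvDl dotv_suml dotvZl -[f y - f x in LHS]mul1r -l1 mulrDl mulr_suml.
  have -> : \sum_(j <- J i) tr_lam tr k i.+1 j * (f y - f x - dotv (g j) (y - x) + err j) =
    \sum_(j <- J i) tr_lam tr k i.+1 j * (f y - f x) -
    \sum_(j <- J i) dotv (tr_lam tr k i.+1 j *: g j) (y - x) +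
    \sum_(j <- J i) tr_lam tr k i.+1 j * err j.
    by rewrite -sumrB -big_split /=; apply: eq_bigr => j _; rewrite dotvZl; ring.
  by ring.
apply: addr_ge0; last by rewrite mulr_ge0 // IHi.
rewrite big_seq; apply: sumr_ge0 => j jJ; rewrite mulr_ge0 ?l0 //.
exact/aux_minorant/D.
Qed.

Lemma aggr_e_ge0 i : entered i -> 0 <= E i.
Proof.
by move=> /(aggr_minorant x); rewrite !subrr dotvC dotv0l sub0r oppr0 add0r.
Qed.

(** The optimal value of the quadratic problem that produces the [i]-th aggregate. *)
Definition bundle_obj i : R :=
  2^-1 * enorm (G i) ^+ 2 + eps `^ (- p_alpha p) * E i.

(** The weights [l] on the newest auxiliary point and [1 - l] on the previous aggregate
    are feasible; expand the quadratic objective at this point. *)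
Lemma bundle_obj_segment i (l : R) : entered i.+1 -> 0 <= l <= 1 ->
  bundle_obj i.+1 <= bundle_obj i +
    l * (dotv (G i) (g (m + i).+1 - G i) + eps `^ (- p_alpha p) * (err (m + i).+1 - E i)) +
    l ^+ 2 / 2 * dotv (g (m + i).+1 - G i) (g (m + i).+1 - G i).
Proof.
move=> ei1 /andP[l0 l1].
have newJ : (m + i).+1 \in J i by apply: index_set_new; case: ei1.
move: ei1 => [_ _ _ _ [[_ opt] _]].
pose l' j : R := if j == (m + i).+1 then l else 0.
have feas : qp_feasible tr k i l' (1 - l).
  split; first by move=> j _; rewrite /l'; case: ifP.
    by rewrite subr_ge0.
  rewrite (sum_fset_single newJ) /l' ?eqxx => [|j /negbTE ->//].
  by rewrite addrC subrK.
have := opt _ _ feas; rewrite -/(bundle_obj i.+1) => /le_trans; apply.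
rewrite /qp_obj (sum_fset_single newJ) => [|j /negbTE jn]; last by rewrite /l' jn scale0r.
rewrite (sum_fset_single newJ) => [|j /negbTE jn]; last by rewrite /l' jn mul0r.
rewrite /l' eqxx /bundle_obj !enorm_sqr.
have -> : l *: g (m + i).+1 + (1 - l) *: G i = G i + l *: (g (m + i).+1 - G i).
  by apply/rowP => a; rewrite !mxE; ring.
set c := eps `^ _; have [D DE] : exists D, D = g (m + i).+1 - G i by eexists.
rewrite -!DE.
rewrite !dotvDl !dotvDr !dotvZl !dotvZr (dotvC D (G i)).
by rewrite le_eqVlt; apply/orP; left; apply/eqP; field.
Qed.

(** The case [v = 0] is the unperturbed trial. If it is rejected, then only because [f]
    is not differentiable there, and the first random trial is accepted. *)
Lemma fdp2_good i (r : R) : 0 <= r -> FDP2_returns f p u tr k i (s (m + i).+1) ->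
  ~ descent_test f p tr k i ->
  good_draw f (p_sigma p) r (x + dir f p tr k i) (u k i.+1 0%N) ->
  exists v, [/\ `|v| <= r, s (m + i).+1 = x + dir f p tr k i + p_sigma p *: v &
    p_beta p * zval f p tr k i < f (s (m + i).+1) - f x].
Proof.
move=> r0 [t [[dt acc] first_ok sE]] nd [[ur asc] nk].
have zf : p_beta p * zval f p tr k i < f (x + dir f p tr k i) - f x.
  by rewrite ltNge; apply/negP.
case: t dt acc first_ok sE => [|[|t]] dt acc first_ok sE.
- by exists 0; rewrite normr0 scaler0 addr0 sE.
- exists (u k i.+1 0%N); split=> //; last by rewrite sE.
  by rewrite sE /= expr0 divr1 addrAC.
- have t1 : (1 < t.+2)%N by [].
  exfalso; apply: (first_ok _ t1) => /=.
  have -> : x + (p_sigma p / 2 ^+ 0) *: u k i.+1 0%N + dir f p tr k i =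
     x + dir f p tr k i + p_sigma p *: u k i.+1 0%N.
    by rewrite expr0 divr1 addrAC.
  split; first by apply: no_kink_differentiable => // j q; exact: nk.
  by apply: lt_le_trans zf _; rewrite lerD2r.
Qed.

Lemma outer_eps_gt0 : outer_entered f p u tr k -> 0 < eps.
Proof.
have [_ eps0 /andP[mu0 _] _ _] := hp.
elim: k => [|k' IHk]; first by move=> [_ ->].
by move=> [/IHk ek [i [_ _ [[_ _ ->//]|[_ _ _ -> _]]]]]; rewrite mulr_gt0.
Qed.

Hypothesis eps_gt0 : 0 < eps.
Hypothesis ent : forall i, entered i.
Local Notation W := bundle_obj.
Local Notation c := (eps `^ (- p_alpha p)).

Let beta_lt1 : 0 < 1 - p_beta p.
Proof. by case: hp => _ _ _ /andP[_ b1] _; rewrite subr_gt0. Qed.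

Let sigma_gt0 : 0 < p_sigma p.
Proof. by case: hp => _ _ _ _ []. Qed.

Let tau_gt0 : 0 < tau.
Proof. exact: powR_gt0. Qed.

Let c_tau : c * tau = 1.
Proof. by rewrite powRN mulVf // gt_eqF. Qed.

Let c_ge0 : 0 <= c.
Proof. exact: powR_ge0. Qed.

Lemma bundle_objE i : W i = 2^-1 * dotv (G i) (G i) + c * E i.
Proof. by rewrite /bundle_obj enorm_sqr. Qed.

Lemma tau_bundle_obj i : tau * W i = 2^-1 * tau * dotv (G i) (G i) + E i.
Proof. by rewrite bundle_objE mulrDr mulrA (mulrC tau c) mulrA c_tau mul1r; ring. Qed.

Lemma bundle_obj_nonincreasing i : W i.+1 <= W i.
Proof.
have l01 : 0 <= (0 : R) <= 1 by rewrite lexx ler01.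
have := bundle_obj_segment (ent i.+1) l01.
by rewrite expr2 !mul0r !addr0.
Qed.

Lemma bundle_obj_mono i i' : (i <= i')%N -> W i' <= W i.
Proof.
move=> ii'; rewrite -(subnKC ii'); elim: (i' - i)%N => [|q]; first by rewrite addn0.
by rewrite addnS; apply: le_trans; exact: bundle_obj_nonincreasing.
Qed.

(** At [y] the minorant reads [gap <= E i - dotv (G i) v]. The inequality
    [- dotv (G i) v <= a / 2 * dotv (G i) (G i) + gap / 2], which is a square
    completed, gives [gap / 2 <= (a + tau) * W i]. *)
Lemma bundle_obj_bounded_below y : f y < f x ->
  exists w0 : R, 0 < w0 /\ forall i, w0 <= W i.
Proof.
move=> fyx.
have [gap gapE] : exists gap, gap = f x - f y by eexists.
have gap0 : 0 < gap by rewrite gapE subr_gt0.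
have [v vE] : exists v, v = y - x by eexists.
have v0 : 0 <= dotv v v by exact: dotv_ge0.
(* The summand 1 makes [a] positive even if [v] vanishes. *)
pose a := (dotv v v + 1) / gap.
have a0 : 0 < a by rewrite divr_gt0 // ltr_wpDl.
have agap : a * gap = dotv v v + 1 by rewrite divfK // gt_eqF.
have at0 : 0 < a + tau by rewrite addr_gt0.
exists (gap / 2 / (a + tau)); split=> [|i]; first by rewrite !divr_gt0.
rewrite ler_pdivrMr // mulrDr [W i * a]mulrC (mulrC (W i)) tau_bundle_obj.
have H := aggr_minorant y (ent i); rewrite -vE in H.
have aW : 2^-1 * a * dotv (G i) (G i) <= a * W i.
  rewrite (mulrC 2^-1 a) -mulrA ler_pM2l // bundle_objE lerDl mulr_ge0 //.
  exact: aggr_e_ge0.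
have tG : 0 <= 2^-1 * tau * dotv (G i) (G i).
  by rewrite !mulr_ge0 ?dotv_ge0 // ltW.
have : 0 <= dotv (a *: G i + v) (a *: G i + v) by exact: dotv_ge0.
rewrite !dotvDl !dotvDr !dotvZl !dotvZr (dotvC v (G i)) => sq.
have : 0 <= a * (a * dotv (G i) (G i) + 2 * dotv (G i) v + gap).
  by rewrite !mulrDr agap; lra.
by rewrite pmulr_rge0 // => sq'; lra.
Qed.

Lemma bundle_obj_ge0 i : 0 <= W i.
Proof.
by rewrite bundle_objE addr_ge0 ?mulr_ge0 ?dotv_ge0 ?aggr_e_ge0.
Qed.

Lemma aggr_g_bounded i j : `|G i 0 j| <= 1 + 2 * W 0%N.
Proof.
have W0 := bundle_obj_ge0 0.
have Gj : `|G i 0 j| ^+ 2 <= 2 * W 0%N.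
  rewrite real_normK ?num_real //; apply: (@le_trans _ _ (dotv (G i) (G i))).
    rewrite /dotv (bigD1 j) //= -expr2 lerDl; apply: sumr_ge0 => l _.
    by rewrite -expr2 sqr_ge0.
  have := bundle_obj_mono (leq0n i); rewrite (bundle_objE i).
  have : 0 <= c * E i by rewrite mulr_ge0 // aggr_e_ge0.
  by lra.
rewrite -(@ler_sqr R) ?nnegrE ?normr_ge0 //; last by lra.
by apply: le_trans Gj _; have := sqr_ge0 (W 0%N); lra.
Qed.

(** The values [W i] decrease, so the aggregates are bounded; hence so are the auxiliary
    points with a perturbation of size at most 1, and the gradients there. *)
Lemma aux_grad_bounded : exists C : R, 0 < C /\ forall i v, `|v| <= 1 ->
  s (m + i).+1 = x + dir f p tr k i + p_sigma p *: v ->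
  forall j, `|g (m + i).+1 0 j| <= C.
Proof.
have B0 : 0 <= 1 + 2 * W 0%N by have := bundle_obj_ge0 0; lra.
pose rho := `|x| + tau * (1 + 2 * W 0%N) + p_sigma p.
have rho0 : 0 < rho by rewrite ltr_wpDl // addr_ge0 // mulr_ge0 // ltW.
have [C [C0 gC]] := grad_bounded hf rho0.
exists C; split=> // i v v1 sE.
apply: gC; first by apply: (aux_diffset (ent i.+1)); rewrite addnS.
rewrite sE (le_trans (ler_normD _ _)) // lerD //.
  rewrite (le_trans (ler_normD _ _)) // lerD2l /dir normrZ normrN gtr0_norm //.
  by rewrite ler_pM2l // normr_le_coord // => j; exact: aggr_g_bounded.
by rewrite normrZ gtr0_norm // ler_piMr // ltW.
Qed.

(** The right-hand side is [tau] times the rate of decrease of the quadratic objective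
    from the aggregate towards the newest auxiliary point. Without perturbation the
    failure of the descent test makes it at least [- (1 - beta) z]; a perturbation
    [v] costs its inner product with the new gradient. *)
Lemma null_step_slope i v :
  s (m + i).+1 = x + dir f p tr k i + p_sigma p *: v ->
  p_beta p * zval f p tr k i < f (s (m + i).+1) - f x ->
  (1 - p_beta p) * (tau * W i) - p_sigma p * dotv (g (m + i).+1) v <=
  tau * - (dotv (G i) (g (m + i).+1 - G i) + c * (err (m + i).+1 - E i)).
Proof.
move=> sE; rewrite /zval enorm_sqr mulNr.
have errE : - err (m + i).+1 = f (s (m + i).+1) - f x
    + tau * dotv (G i) (g (m + i).+1) - p_sigma p * dotv (g (m + i).+1) v.
  rewrite /lin_err.
  have -> : x - s (m + i).+1 = tau *: G i - p_sigma p *: v.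
    by rewrite sE /dir; apply/rowP => l; rewrite !mxE; ring.
  by rewrite dotvDr dotvNr !dotvZr (dotvC (g _) (G i)); ring.
have -> : tau * - (dotv (G i) (g (m + i).+1 - G i) + c * (err (m + i).+1 - E i)) =
    - tau * dotv (G i) (g (m + i).+1) + tau * dotv (G i) (G i)
    + (c * tau) * (- err (m + i).+1 + E i).
  by rewrite dotvDr dotvNr; ring.
rewrite c_tau mul1r errE tau_bundle_obj.
have tG0 : 0 <= tau * dotv (G i) (G i) by rewrite mulr_ge0 ?dotv_ge0 // ltW.
move: (tau * dotv (G i) (G i)) (mulrA 2^-1 tau (dotv (G i) (G i))) tG0 => t <- t0.
have := mulr_ge0 (ltW beta_lt1) t0.
rewrite mulNr; move: (tau * dotv (G i) _) (p_sigma p * _) (f _ - f x) (E i).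
by move=> Gg gv fs e; lra.
Qed.

(** Take [l = d0 / (K + d0)], which almost minimizes the quadratic bound and lies
    between 0 and 1. *)
Lemma segment_decrease (w w' delta D d0 K : R) : 0 < d0 -> d0 <= delta -> D <= K -> 0 <= K ->
  (forall l, 0 <= l <= 1 -> w' <= w + l * - delta + l ^+ 2 / 2 * D) ->
  w' <= w - d0 ^+ 2 / (K + d0) / 2.
Proof.
move=> d00 dd DK K0 seg.
have Kd0 : 0 < K + d0 by rewrite ltr_wpDl.
pose l := d0 / (K + d0).
have l01 : 0 <= l <= 1.
  by rewrite /l divr_ge0 ?(ltW d00) ?(ltW Kd0) //= ler_pdivrMr // mul1r lerDr.
apply: le_trans (seg l l01) _; rewrite -addrA lerD2l mulrN.
case/andP: l01 => l0 _.
have h1 : l * d0 <= l * delta by rewrite ler_wpM2l.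
have h2 : l ^+ 2 / 2 * D <= l ^+ 2 / 2 * (K + d0).
  rewrite ler_wpM2l //; first by rewrite divr_ge0 // sqr_ge0.
  by rewrite (le_trans DK) // lerDl ltW.
have h3 : l * d0 = 2 * (d0 ^+ 2 / (K + d0) / 2) by rewrite /l; field; rewrite gt_eqF.
have h4 : l ^+ 2 / 2 * (K + d0) = d0 ^+ 2 / (K + d0) / 2.
  by rewrite /l; field; rewrite gt_eqF.
move: h1 h2 h3 h4; set X := l * d0; set Y := l * delta; set Z := _ * D.
by set eta := d0 ^+ 2 / _ / _ => h1 h2 h3 h4; lra.
Qed.

(** The radius [r] is such that the perturbation consumes at most one half of the rate
    of decrease [(1 - beta) w0] of the unperturbed step. *)
Lemma good_step_decrease (w0 : R) : 0 < w0 -> (forall i, w0 <= W i) ->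
  exists r eta : R, [/\ 0 < r, 0 < eta & forall i r', 0 <= r' <= r ->
    good_draw f (p_sigma p) r' (x + dir f p tr k i) (u k i.+1 0%N) ->
    W i.+1 <= W i - eta].
Proof.
move=> w00 Ww0.
have [C [C0 gC]] := aux_grad_bounded.
pose B := 1 + 2 * W 0%N.
have B0 : 0 <= B by have := bundle_obj_ge0 0; rewrite /B; lra.
have CB0 : 0 <= C + B by rewrite addr_ge0 // ltW.
have nC0 : 0 < n.+1%:R * C by rewrite mulr_gt0 // ltr0n.
pose r := Num.min 1 ((1 - p_beta p) * tau * w0 / 2 / (p_sigma p * (n.+1%:R * C))).
pose K := n%:R * (C + B) * (C + B).
pose d0 := (1 - p_beta p) * w0 / 2.
have K0 : 0 <= K by rewrite !mulr_ge0.
have d00 : 0 < d0 by rewrite !divr_gt0 // mulr_gt0.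
have rsmall : p_sigma p * (n.+1%:R * C) * r <= (1 - p_beta p) * tau * w0 / 2.
  by rewrite mulrC -ler_pdivlMr ?mulr_gt0 // ge_min lexx orbT.
exists r, (d0 ^+ 2 / (K + d0) / 2); split.
- by rewrite lt_min ltr01 /= !divr_gt0 // !mulr_gt0.
- by rewrite !divr_gt0 // ?exprn_gt0 // ltr_wpDl.
move=> i r' /andP[r'0 r'r] gd.
have [_ [_ nd] fdp _ _] := ent i.+1.
have [z [zr' sE zf]] := fdp2_good r'0 fdp nd gd.
have zr : `|z| <= r by apply: le_trans zr' r'r.
have r1 : r <= 1 by rewrite ge_min lexx.
have gs := gC i z (le_trans zr r1) sE.
apply: (segment_decrease (K := K) d00 _ _ K0 (delta :=
    - (dotv (G i) (g (m + i).+1 - G i) + c * (err (m + i).+1 - E i)))); first 1 last.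
- have cb j : `|(g (m + i).+1 - G i) 0 j| <= C + B.
    rewrite mxE [X in _ + X]mxE (le_trans (ler_normB _ _)) // lerD //.
    exact: aggr_g_bounded.
  apply: (le_trans (ler_norm _)); apply: (le_trans (dotv_norm_le _ cb)).
  by rewrite ler_wpM2l ?mulr_ge0 // normr_le_coord.
- by move=> l l01; rewrite opprK; exact: bundle_obj_segment (ent i.+1) l01.
rewrite -(ler_pM2l tau_gt0); apply: le_trans (null_step_slope sE zf).
have gz : p_sigma p * dotv (g (m + i).+1) z <= p_sigma p * (n.+1%:R * C) * r.
  rewrite -mulrA ler_pM2l // (le_trans (ler_norm _)) // (le_trans (dotv_norm_le _ gs)) //.
  rewrite ler_pM // ?mulr_ge0 ?(ltW C0) //.
  by rewrite ler_wpM2r ?(ltW C0) // ler_nat.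
have tW : (1 - p_beta p) * (tau * w0) <= (1 - p_beta p) * (tau * W i).
  by rewrite !ler_pM2l.
have -> : tau * d0 = (1 - p_beta p) * (tau * w0) / 2 by rewrite /d0; field.
move: rsmall; rewrite -[(1 - p_beta p) * tau * w0]mulrA.
by move: ((1 - p_beta p) * _) ((1 - p_beta p) * _) (_ * dotv _ _) (_ * r) tW gz => t1 t2 t3 t4; lra.
Qed.

Lemma infinite_loop_minimizer :
  (forall r : R, 0 < r -> forall N, exists i r', [/\ (N <= i)%N, 0 <= r' <= r &
     good_draw f (p_sigma p) r' (x + dir f p tr k i) (u k i.+1 0%N)]) ->
  forall y, f x <= f y.
Proof.
move=> good y; rewrite leNgt; apply/negP => /bundle_obj_bounded_below[w0 [w00 Ww0]].
have [r [eta [r0 eta0 step]]] := good_step_decrease w00 Ww0.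
have drop M : exists i, W i <= W 0%N - M%:R * eta.
  elim: M => [|M [i Wi]]; first by exists 0%N; rewrite mul0r subr0.
  have [i' [r' [ii' rr' gd]]] := good r r0 i; exists i'.+1.
  apply: (le_trans (step i' r' rr' gd)); rewrite -natr1 mulrDl mul1r opprD addrA.
  by rewrite lerD2r (le_trans (bundle_obj_mono ii')).
have [i Wi] := drop (Num.truncn (W 0%N / eta)).+1.
have := le_trans (bundle_obj_ge0 i) Wi; rewrite subr_ge0 -ler_pdivlMr // leNgt.
by rewrite truncnS_gt.
Qed.
End Run.

(** * The random run *)

(** Along a run this is [aggr_g]. It is a Borel function of the trace because [grad]
    is replaced by [borel_grad] and the sum over the random index set by a sum over
    a fixed range. *)
Fixpoint borel_aggr_g (R : realType) (n m : nat) (f : 'rV[R]_n -> R) (tr : bgs_trace R n)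
    (k i : nat) : 'rV[R]_n :=
  match i with
  | 0 => \sum_(j < m.+1) tr_lam tr k 0%N j *: borel_grad f (tr_s tr k j)
  | i'.+1 => \sum_(j < (m + i').+2)
        (if (j : nat) \in tr_J tr k i' then tr_lam tr k i j else 0) *:
          borel_grad f (tr_s tr k j)
      + tr_tlam tr k i *: borel_aggr_g m f tr k i'
  end.

Definition borel_target (R : realType) (n : nat) (f : 'rV[R]_n -> R) (p : bgs_params R n)
    (tr : bgs_trace R n) (k i : nat) : 'rV[R]_n :=
  tr_x tr k + - (tr_eps tr k `^ p_alpha p) *: borel_aggr_g (p_m p) f tr k i.

(** The indices in use never exceed [m + i + 1] and designate points at which [f] is
    differentiable. *)
Lemma borel_aggr_gE (R : realType) (n : nat) (f : 'rV[R]_n -> R) (p : bgs_params R n)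
    (u : nat -> nat -> nat -> 'rV[R]_n) (tr : bgs_trace R n) (k i : nat) :
  inner_entered f p u tr k i ->
  borel_aggr_g (p_m p) f tr k i = aggr_g f p tr k i.
Proof.
elim: i => [|i IHi] ei /=.
  case: ei => _ D _ _; apply: eq_bigr => j _; rewrite borel_gradE //.
  by apply: D; rewrite -ltnS.
have [ei' _ _ _ _] := ei.
rewrite IHi //; congr (_ + _).
rewrite (@sum_fset_ord _ _ (p_m p + i).+2); last first.
  by move=> j jJ; rewrite ltnS; exact: (index_set_le ei').
apply: eq_bigr => j _; case: ifPn => jJ; last by rewrite scale0r.
by rewrite borel_gradE //; exact: (index_diffset ei).
Qed.

Lemma borel_targetE (R : realType) (n : nat) (f : 'rV[R]_n -> R) (p : bgs_params R n)
    (u : nat -> nat -> nat -> 'rV[R]_n) (tr : bgs_trace R n) (k i : nat) :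
  inner_entered f p u tr k i ->
  borel_target f p tr k i = tr_x tr k + dir f p tr k i.
Proof. by move=> ei; rewrite /borel_target /dir (borel_aggr_gE ei). Qed.

Section Information.
Context (R : realType) (n : nat) (d : measure_display) (Omega : measurableType d).
Context (G : set (set Omega)).
Hypothesis sG : sigma_algebra setT G.
Local Notation OG := (g_sigma_algebraType G : measurableType _).
Local Notation rVb := (rVborel R n).

Lemma measurable_infoE (A : set OG) : measurable A = G A.
Proof. by rewrite /measurable /= sigma_algebra_id. Qed.

Lemma meas_wrtP d' (Y : measurableType d') (X : Omega -> Y) :
  meas_wrt G measurable X <-> measurable_fun setT (X : OG -> Y).
Proof.
split=> [mX _ A mA|mX A mA]; first by rewrite setTI measurable_infoE; exact: mX.
by rewrite -measurable_infoE -[X in measurable X]setTI; exact: mX.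
Qed.

Lemma meas_wrt_borelP (X : Omega -> 'rV[R]_n) :
  meas_wrt G (@borel R n) X <-> measurable_fun setT (X : OG -> rVb).
Proof. exact: (@meas_wrtP _ rVb). Qed.

End Information.

Section AdaptedRun.
Context (R : realType) (n : nat) (f : 'rV[R]_n -> R) (p : bgs_params R n).
Context (d : measure_display) (Omega : measurableType d) (P : probability Omega R).
Context (F : nat -> nat -> nat -> set (set Omega)).
Context (U : nat -> nat -> nat -> Omega -> 'rV[R]_n) (T : Omega -> bgs_trace R n).
Hypothesis hf : convex_function (setT : set 'rV[R]_n) f.
Hypothesis hp : admissible f p.
Hypothesis hU : uniform_draws P F U.
Hypothesis hT : adapted (p_m p) F T.
Local Notation m := (p_m p).
Local Notation rVb := (rVborel R n).

Let sF k a t : sigma_algebra setT (F k a t).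
Proof. by case: hU => H _ _ _; case: (H k a t). Qed.

Let subF k a t : F k a t `<=` (measurable : set (set Omega)).
Proof. by case: hU => H _ _ _; case: (H k a t). Qed.

Let monoF k a a' : (a <= a')%N -> F k a 0%N `<=` F k a' 0%N.
Proof.
rewrite leq_eqVlt => /orP[/eqP->//|aa']; case: hU => _ H _ _; apply: H.
by right; split => //; left.
Qed.

Let wrt_mono k a a' (Y : Type) (S : set (set Y)) (X : Omega -> Y) : (a <= a')%N ->
  meas_wrt (F k a 0%N) S X -> meas_wrt (F k a' 0%N) S X.
Proof. by move=> aa' mX A SA; apply: (monoF aa'); exact: mX. Qed.

Lemma measurable_borel_aggr_g k i :
  meas_wrt (F k i.+1 0%N) (@borel R n) (fun w => borel_aggr_g m f (T w) k i).
Proof.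
have [_ hs hs' hl hJ] := hT.
have ms i' j : (j <= m + i')%N ->
    meas_wrt (F k i'.+1 0%N) (@borel R n) (fun w => tr_s (T w) k j).
  have [jm _|mj] := leqP j m; first by apply: (@wrt_mono _ 1%N) => //; exact: hs.
  move=> jm; have -> : j = (m + (j - m.+1)).+1 by rewrite -addSn subnKC.
  apply: (@wrt_mono _ (j - m.+1).+2); last exact: hs'.
  by rewrite ltnS ltn_subLR // addSn ltnS.
have mbs i' j : (j <= m + i')%N ->
    measurable_fun setT ((fun w => borel_grad f (tr_s (T w) k j)) :
      g_sigma_algebraType (F k i'.+1 0%N) -> rVb).
  move=> jm; apply: (measurableT_comp (measurable_borel_grad hf)).
  apply/(meas_wrt_borelP (sF _ _ _)); exact: ms.
elim: i => [|i IHi].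
  apply/(meas_wrt_borelP (sF _ _ _)) => /=.
  apply: (@measurable_combination R n _ (g_sigma_algebraType (F k 1%N 0%N)) m.+1
    (fun j w => tr_lam (T w) k 0%N j) (fun j w => borel_grad f (tr_s (T w) k j))) => j jm.
    by apply/(meas_wrtP (sF _ _ _)); case: (hl k 0%N).
  by apply: mbs; rewrite addn0 -ltnS.
apply/(meas_wrt_borelP (sF _ _ _)) => /=.
apply: measurable_addv; last first.
  apply: measurable_scalev.
    by apply/(meas_wrtP (sF _ _ _)); case: (hl k i.+1).
  by apply/(meas_wrt_borelP (sF _ _ _)); apply: wrt_mono IHi.
apply: (@measurable_combination R n _ (g_sigma_algebraType (F k i.+2 0%N)) (m + i).+2
  (fun j w => if j \in tr_J (T w) k i then tr_lam (T w) k i.+1 j else 0)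
  (fun j w => borel_grad f (tr_s (T w) k j))) => j jm.
  apply: measurable_fun_ifT => //; last by apply/(meas_wrtP (sF _ _ _)); case: (hl k i.+1).
  apply/(meas_wrtP (sF _ _ _)); apply: (@wrt_mono _ i.+1) => // A _.
  exact: (hJ k i [set K : {fset nat} | A (j \in K)] Logic.I).
by apply: mbs; rewrite addnS -ltnS.
Qed.

Lemma measurable_borel_target k i :
  meas_wrt (F k i.+1 0%N) (@borel R n) (fun w => borel_target f p (T w) k i).
Proof.
have [hx _ _ _ _] := hT; have [hxk hek] := hx k.
apply/(meas_wrt_borelP (sF _ _ _)); apply: measurable_addv.
  by apply/(meas_wrt_borelP (sF _ _ _)); exact: wrt_mono hxk.
apply: measurable_scalev.
  apply: measurable_funN; apply: (measurableT_comp (measurable_powR _)).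
  by apply/(meas_wrtP (sF _ _ _)); exact: wrt_mono hek.
by apply/(meas_wrt_borelP (sF _ _ _)); exact: measurable_borel_aggr_g.
Qed.

(** The target of the inner iteration [i] is known when the draw [(k, i + 1, 0)] is
    made, and both are known at the next inner iteration. *)
Lemma good_draws_recur k (r : R) : 0 < r -> r *+ 2 <= n.+1%:R^-1 ->
  {ae P, forall w, forall N, exists2 i, (N <= i)%N &
    good_draw f (p_sigma p) r (borel_target f p (T w) k i) (U k i.+1 0%N w)}.
Proof.
move=> r0 rn.
have [_ _ _ _ [sigma0 _ _ _]] := hp.
have [_ _ pastU unifU] := hU.
have next i : draw_lt k i.+1 0%N k i.+2 0%N by right; split => //; left.
have mU i A : borel A -> measurable (U k i.+1 0%N @^-1` A).
  by move=> bA; apply: (@subF k i.+2 0%N); exact: pastU.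
have uU i E A : F k i.+1 0%N E -> borel A ->
   P (E `&` U k i.+1 0%N @^-1` A) = (P E * (unif_ball A)%:E)%E by exact: unifU.
have rn' : r <= n.+1%:R^-1 by apply: le_trans rn; rewrite mulr2n lerDl ltW.
pose q := unif_ball (cube r : set 'rV[R]_n) / 2.
have q0 : 0 < q.
  rewrite divr_gt0 //.
  exact: (@unif_cube_gt0 R n _ _ P _ _ (sF k 1%N 0%N) (uU 0%N)).
apply: (@recurrence R _ _ P (fun i => F k i.+1 0%N) (fun i => [set w |
    good_draw f (p_sigma p) r (borel_target f p (T w) k i) (U k i.+1 0%N w)]) q) => //.
- by move=> i; exact: monoF.
- move=> i; rewrite -(measurable_infoE (sF _ _ _)) -[X in measurable X]setTI.
  have mp : measurable_fun setT ((fun w => (borel_target f p (T w) k i, U k i.+1 0%N w)) :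
      g_sigma_algebraType (F k i.+2 0%N) -> rVb * rVb).
    apply: measurable_fun_pair; apply/(meas_wrt_borelP (sF _ _ _)).
      by apply: (@wrt_mono _ i.+1) => //; exact: measurable_borel_target.
    by move=> A bA; exact: pastU.
  exact: (mp measurableT _ (measurable_good (p_sigma p) r hf)).
- move=> i E FE.
  apply: (@draw_freezing R n _ _ P _ _ (sF k i.+1 0%N) _ (mU i) (uU i) E
     (fun w => borel_target f p (T w) k i) [set z | good_draw f (p_sigma p) r z.1 z.2]) => //.
  + exact: measurable_borel_target.
  + exact: measurable_good.
  + exact: ltW.
  + move=> y.
    exact: (unif_good_draw (sF k i.+1 0%N) (mU i) (uU i)).
Qed.
End AdaptedRun.

Theorem theorem4 (R : realType) (n : nat) (f : 'rV[R]_n -> R)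
  (p : bgs_params R n)
  (d : measure_display) (Omega : measurableType d) (P : probability Omega R)
  (F : nat -> nat -> nat -> set (set Omega))
  (U : nat -> nat -> nat -> Omega -> 'rV[R]_n)
  (T : Omega -> bgs_trace R n)
  (hf : convex_function (classical_sets.setT : set 'rV[R]_n) f)
  (hp : admissible f p)
  (hU : uniform_draws P F U)
  (hT : adapted (p_m p) F T) :
  {ae P, forall w, forall kbar : nat,
     inner_loop_infinite f p (fun k a t => U k a t w) (T w) kbar ->
     subdiff f (tr_x (T w) kbar) 0%R}.
Proof.
pose r q : R := (n.+1%:R * 2 * q.+1%:R)^-1.
have r0 q : 0 < r q by rewrite invr_gt0 !mulr_gt0 // ltr0n.
have rn q : r q *+ 2 <= n.+1%:R^-1.
  rewrite /r !invfM -mulrnAl -mulrnAr -[2^-1 *+ 2]mulr_natr mulVf // mulr1.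
  by rewrite ler_piMr ?invr_ge0 ?ler0n // invf_le1 ?ltr0n // ler1n.
have rec : {ae P, forall w, forall k q N, exists2 i, (N <= i)%N &
    good_draw f (p_sigma p) (r q) (borel_target f p (T w) k i) (U k i.+1 0%N w)}.
  by apply/ae_foralln => k; apply/ae_foralln => q; exact: (good_draws_recur hf hp hU hT k (r0 q) (rn q)).
apply: filterS rec => w rec k [ok ik] y; rewrite dotv0l addr0.
apply: (infinite_loop_minimizer hf hp (outer_eps_gt0 hp ok) ik).
move=> e e0 N.
have [q] := ltr_add_invr e0; rewrite add0r => qe.
have [i Ni gd] := rec k q N.
exists i, (r q); split => //; last by rewrite -(borel_targetE (ik i)).
rewrite (ltW (r0 q)) (le_trans _ (ltW qe)) // /r invfM ler_piMl ?invr_ge0 ?ler0n //.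
by rewrite invf_le1 ?mulr_gt0 ?ltr0n // -natrM ler1n.
Qed.
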